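(* Let $M_n$ denote the menage numbers (defined in the context), with $M_0=1$. Then for all integers $n>1$, $$M_n = 2\cdot n!\cdot \int_0^{\infty} \left( \left( \frac{t-2+\sqrt{t^2-4t}}{2} \right)^n + \left( \frac{t-2-\sqrt{t^2-4t}}{2} \right)^n \right) e^{-t}\, dt.$$ Furthermore, $$\sum_{n=0}^{\infty} M_n \frac{x^n}{n!} = -1 - 2x + 2 \int_0^\infty \frac{x^2-1}{xt - (x+1)^2}\, e^{-t}\, dt = -1 + 2x + 2\cdot\frac{1-x}{1+x}\cdot \sum_{k=0}^{\infty} \frac{k!\, x^k}{(1+x)^{2k}} = -1 + 2x + 2\cdot\frac{1-x^2}{x}\cdot e^{-\frac{(x+1)^2}{x}}\cdot \operatorname{Ei}\!\left(\frac{(x+1)^2}{x}\right),$$ where $\operatorname{Ei}$ is the exponential integral.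
   Context: For $n\ge 1$, $M_n$ is the number of ways to seat $n$ married couples (each couple consisting of one woman and one man) at $2n$ distinguishable seats arranged around a circular table so that no two spouses occupy adjacent seats and women and men alternate around the table; by convention $M_0=1$ (and $M_1=0$). The generating-function identities are identities of formal power series in $x$ (the series on the left has zero radius of convergence): integrals $\int_0^\infty g\, e^{-t}\,dt$ are understood via the series Laplace transform, i.e. $g$ is expanded as a power series in $x$ whose coefficients are polynomials in $t$, and each $t^k$ is replaced by $\int_0^\infty t^k e^{-t}dt = k!$; the last expression, involving $\operatorname{Ei}$, is to be read via the identity $\sum_{k\ge0} k!\,y^k = \frac{e^{-1/y}}{y}\operatorname{Ei}(1/y)$ used in the same formal (asymptotic) sense with $y=x/(1+x)^2$. In the first formula, $\sqrt{t^2-4t}$ is imaginary for $0<t<4$, but the sum of the two $n$-th powers is real.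
   Formalization: In the first generating-function expression the printed ''-1 - 2x'' is corrected to ''-1 + 2x''; with the minus sign the coefficient of x would be -4, whereas M_1 = 0, and the expression would differ from the next one by 4x. *)

(* Defs.v *)
From HB Require Import structures.
From mathcomp Require Import all_boot all_order all_algebra.
From mathcomp Require Import all_classical all_reals all_analysis.
From mathcomp Require Import complex.

Set Implicit Arguments.
Unset Strict Implicit.
Unset Printing Implicit Defensive.

Import Order.TTheory GRing.Theory Num.Theory.
Import numFieldNormedType.Exports.

Local Open Scope classical_set_scope.
Local Open Scope ring_scope.

(* A person is a pair (couple, sex), and the 2n distinguishable seats around
   the table are the elements of 'I_n.*2, seat i being next to the seat
   ordS i, i.e. i + 1 modulo 2n. *)
Definition menage_seating (n : nat)
    (s : {ffun 'I_n.*2 -> 'I_n * bool}) : bool :=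
  [&& injectiveb s,
      [forall i, (s i).2 != (s (ordS i)).2] &
      [forall i, (s i).1 != (s (ordS i)).1]].

(* For n = 0 the empty seating is counted, so that menage 0 = 1. *)
Definition menage (n : nat) : nat :=
  #|[set s : {ffun 'I_n.*2 -> 'I_n * bool} | menage_seating s]|.

(* Formal power series; a record rather than an alias of nat -> A, which
   already carries the pointwise ring structure. *)
Record fps (A : Type) := Fps { fps_coef : nat -> A }.

HB.instance Definition _ (A : Type) := gen_eqMixin (fps A).
HB.instance Definition _ (A : Type) := gen_choiceMixin (fps A).

Lemma fpsP (A : Type) (f g : fps A) :
  (forall n, fps_coef f n = fps_coef g n) -> f = g.
Proof. by case: f g => [f] [g] /= fg; congr Fps; exact/funext. Qed.

Section FpsZmodule.
Variable A : zmodType.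
Implicit Types f g : fps A.

Definition fps_add f g := Fps (fun n => fps_coef f n + fps_coef g n).
Definition fps_opp f := Fps (fun n => - fps_coef f n).
Definition fps_zero : fps A := Fps (fun=> 0).

Lemma fps_addA : associative fps_add.
Proof. by move=> f g h; apply: fpsP => n /=; rewrite addrA. Qed.

Lemma fps_addC : commutative fps_add.
Proof. by move=> f g; apply: fpsP => n /=; rewrite addrC. Qed.

Lemma fps_add0 : left_id fps_zero fps_add.
Proof. by move=> f; apply: fpsP => n /=; rewrite add0r. Qed.

Lemma fps_addN : left_inverse fps_zero fps_opp fps_add.
Proof. by move=> f; apply: fpsP => n /=; rewrite addNr. Qed.

HB.instance Definition _ :=
  GRing.isZmodule.Build (fps A) fps_addA fps_addC fps_add0 fps_addN.

Lemma fps_coefD f g n : fps_coef (f + g) n = fps_coef f n + fps_coef g n.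
Proof. by []. Qed.

Lemma fps_coefN f n : fps_coef (- f) n = - fps_coef f n.
Proof. by []. Qed.

Lemma fps_coef0 n : fps_coef (0 : fps A) n = 0.
Proof. by []. Qed.

Lemma fps_coef_sum (I : Type) (r : seq I) (P : pred I) (F : I -> fps A) n :
  fps_coef (\sum_(i <- r | P i) F i) n = \sum_(i <- r | P i) fps_coef (F i) n.
Proof.
by elim/big_rec2: _ => [|i y x _ <-]; rewrite ?fps_coef0 ?fps_coefD.
Qed.

End FpsZmodule.

Section FpsRing.
Variable A : comNzRingType.
Implicit Types f g h : fps A.

Definition fps_one : fps A := Fps (fun n => (n == 0)%:R).
Definition fps_mul f g : fps A :=
  Fps (fun n => \sum_(i < n.+1) fps_coef f i * fps_coef g (n - i)%N).

Let trunc m f : {poly A} := \poly_(i < m.+1) fps_coef f i.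

Let coef_trunc m f n : (n <= m)%N -> (trunc m f)`_n = fps_coef f n.
Proof. by move=> nm; rewrite coef_poly ltnS nm. Qed.

Let coef_truncM m f g n : (n <= m)%N ->
  (trunc m f * trunc m g)`_n = fps_coef (fps_mul f g) n.
Proof.
move=> nm; rewrite coefM /=; apply: eq_bigr => i _.
have im : (i <= m)%N by rewrite (leq_trans _ nm)// -ltnS.
have nim : (n - i <= m)%N by rewrite (leq_trans _ nm)// leq_subr.
by rewrite (coef_trunc f im) (coef_trunc g nim).
Qed.

Lemma fps_mulA : associative fps_mul.
Proof.
move=> f g h; apply: fpsP => n.
have le_ord (i : 'I_n.+1) : (i <= n)%N by rewrite -ltnS.
transitivity ((trunc n f * (trunc n g * trunc n h))`_n).
  rewrite [RHS]coefM /=; apply: eq_bigr => i _.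
  by rewrite (coef_trunc f (le_ord i)) (coef_truncM g h (leq_subr i n)).
rewrite mulrA coefM /=; apply: eq_bigr => i _.
by rewrite (coef_truncM f g (le_ord i)) (coef_trunc h (leq_subr i n)).
Qed.

Lemma fps_mulC : commutative fps_mul.
Proof.
move=> f g; apply: fpsP => n.
by rewrite -(coef_truncM f g (leqnn n)) -(coef_truncM g f (leqnn n)) mulrC.
Qed.

Lemma fps_mul1 : left_id fps_one fps_mul.
Proof.
move=> f; apply: fpsP => n /=; rewrite big_ord_recl /= subn0 mul1r.
by rewrite big1 ?addr0// => i _; rewrite mul0r.
Qed.

Lemma fps_mulD : left_distributive fps_mul +%R.
Proof.
move=> f g h; apply: fpsP => n /=; rewrite -big_split /=.
by apply: eq_bigr => i _; rewrite mulrDl.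
Qed.

Lemma fps_one_neq0 : fps_one != 0.
Proof.
apply/eqP => /(congr1 (fun f : fps A => fps_coef f 0%N)) /= /eqP.
by rewrite oner_eq0.
Qed.

HB.instance Definition _ := GRing.Zmodule_isComNzRing.Build (fps A)
  fps_mulA fps_mulC fps_mul1 fps_mulD fps_one_neq0.

Lemma fps_coef1 n : fps_coef (1 : fps A) n = (n == 0)%:R.
Proof. by []. Qed.

Lemma fps_coefM f g n : fps_coef (f * g) n =
  \sum_(i < n.+1) fps_coef f i * fps_coef g (n - i)%N.
Proof. by []. Qed.

Lemma fps_coefX_small f k n :
  fps_coef f 0 = 0 -> (n < k)%N -> fps_coef (f ^+ k) n = 0.
Proof.
move=> f0; elim: k n => [//|k IH] n nk.
rewrite exprS fps_coefM big_ord_recl f0 mul0r add0r big1// => i _.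
case: n nk i => [|n] nk i; first by case: i.
by rewrite lift0 subSS IH ?mulr0// (leq_ltn_trans (leq_subr _ _)).
Qed.

End FpsRing.

Definition fpsC (A : nmodType) (a : A) : fps A :=
  Fps (fun n => if n is 0 then a else 0).
Definition fpsX (A : pzRingType) : fps A := Fps (fun n => (n == 1)%:R).

Section FpsUnitRing.
Variable A : comUnitRingType.
Implicit Types f g : fps A.

Definition fps_unit : {pred fps A} := fun f => fps_coef f 0 \is a GRing.unit.

(* 1 / f = f_0^-1 * \sum_k u^k with u = 1 - f / f_0 of positive order. *)
Definition fps_inv f : fps A :=
  if fps_unit f then
    let a := fpsC (fps_coef f 0)^-1 in
    Fps (fun n => fps_coef (a * \sum_(k < n.+1) (1 - a * f) ^+ k) n)
  else f.

Lemma fps_mulVr : {in fps_unit, left_inverse 1 fps_inv *%R}.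
Proof.
move=> f fu; rewrite /fps_inv [fps_unit f]fu.
set a := fpsC _; set u := 1 - a * f.
have u0 : fps_coef u 0 = 0.
  rewrite fps_coefD fps_coefN fps_coef1 fps_coefM big_ord1 subn0 /=.
  by rewrite mulVr// subrr.
pose G m := a * \sum_(k < m.+1) u ^+ k.
have GE m n : (n <= m)%N -> fps_coef (G m) n = fps_coef (G n) n.
  move=> nm; rewrite /G !fps_coefM; apply: eq_bigr => i _; congr (_ * _).
  rewrite !fps_coef_sum -(subnKC nm) -addSn big_split_ord /=.
  rewrite [X in _ + X]big1 ?addr0// => j _.
  rewrite fps_coefX_small// (@leq_ltn_trans n) ?leq_subr//.
  by rewrite addSn ltnS leq_addr.
apply: fpsP => n; rewrite fps_coefM.
transitivity (fps_coef (G n * f) n).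
  rewrite fps_coefM; apply: eq_bigr => i _; congr (_ * _).
  by rewrite [RHS]GE// -ltnS.
have -> : G n * f = 1 - u ^+ n.+1.
  have -> : 1 - u ^+ n.+1 = (1 - u) * \sum_(k < n.+1) u ^+ k.
    have := subrXX 1 u n.+1; rewrite expr1n => ->; congr (_ * _).
    by apply: eq_bigr => i _; rewrite expr1n mul1r.
  by rewrite (subKr 1 (a * f)) mulrAC.
by rewrite fps_coefD fps_coefN fps_coefX_small// subr0.
Qed.

Lemma fps_unitPl f g : g * f = 1 -> fps_unit f.
Proof.
move=> /(congr1 (fun f : fps A => fps_coef f 0)).
rewrite fps_coefM big_ord1 subn0 fps_coef1 eqxx => gf.
by apply/unitrPr; exists (fps_coef g 0); rewrite mulrC.
Qed.

Lemma fps_inv_out : {in [predC fps_unit], fps_inv =1 id}.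
Proof. by move=> f /negbTE; rewrite /fps_inv /in_mem /= => ->. Qed.

HB.instance Definition _ := GRing.ComNzRing_hasMulInverse.Build (fps A)
  fps_mulVr fps_unitPl fps_inv_out.

End FpsUnitRing.

(* The sum of an x-adically summable (locally finite) family. *)
Definition fps_sum (A : zmodType) (F : nat -> fps A) : fps A :=
  Fps (fun n => \sum_(k \in [set: nat]) fps_coef (F k) n).

Section Integrals.
Variable R : realType.
Local Notation mu := (@lebesgue_measure R).

(* \int_0^oo g e^{-t} dt for a series g in x over R[t]: in each coefficient,
   t^k is replaced by \int_0^oo t^k e^{-t} dt. *)
Definition laplace (g : fps {poly R}) : fps R :=
  Fps (fun n => \sum_(k < size (fps_coef g n)) (fps_coef g n)`_k *
    \int[mu]_(t in `[0, +oo[) (t ^+ k * expR (- t))).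

Definition Cintegral (D : set R) (f : R -> R[i]) : R[i] :=
  Complex (\int[mu]_(t in D) complex.Re (f t))
          (\int[mu]_(t in D) complex.Im (f t)).

(* Cauchy principal value at 0 of \int_(-oo)^z e^t / t dt. *)
Definition Ei (z : R) : R :=
  lim ((fun e : R =>
    \int[mu]_(t in [set t | t <= z /\ e <= `|t|]) (expR t / t)) @ 0^'+).

(* Poincare asymptotic expansion F(x) ~ \sum_n s_n x^n as x -> 0, x != 0. *)
Definition asymptotic_to (F : R -> R) (s : fps R) : Prop :=
  forall N : nat,
    (fun x => F x - \sum_(n < N.+1) fps_coef s n * x ^+ n)
      =o_ (0^') (fun x => x ^+ N).

Definition menage_egf : fps R := Fps (fun n => (menage n)%:R / n`!%:R).

End Integrals.

(* Main.v *)
Require Import Defs.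
From HB Require Import structures.
From mathcomp Require Import all_boot all_order all_fingroup all_algebra.
From mathcomp Require Import all_classical all_reals all_analysis.
From mathcomp Require Import measurable_realfun complex ring lra zify.

Set Implicit Arguments.
Unset Strict Implicit.
Unset Printing Implicit Defensive.

Import Order.TTheory GRing.Theory Num.Theory.
Import numFieldNormedType.Exports.

(* A seating is a choice of the sex on even seats, a permutation placing that
   sex, and a permutation [u] of Z/n with [u i <> i, i + 1] placing the spouses.
   Expanding [\prod_i (1 - [u i = i] - [u i = i + 1])] over the choice made at
   each [i], a consistent choice of [k] positions is satisfied by [(n - k)!]
   permutations, and consistency is a condition on neighbouring choices only.
   Replacing [(n - k)!] by [t^(n - k)], the count thus becomes the trace of the
   [n]-th power of a 3 x 3 transfer matrix with eigenvalues [0, a, b] where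
   [a + b = t - 2] and [a b = 1], and [t^k |-> k!] is integration against
   [e^(-t)]. The power series identities follow from the linear recurrence for
   these traces and a geometric expansion. For the asymptotics,
   [e^t / t - d/dt (e^t \sum_(k < N) k! / t^(k + 1)) = N! e^t / t^(N + 1)], and
   integrating this gives the expansion of [Ei]: by alternating signs at [-oo],
   and by comparison with the derivative of [2 N! e^t / t^(N + 1)] at [+oo]. *)

Local Open Scope ring_scope.

(** * Permutations avoiding two cyclic positions *)

Lemma perm_extension (T : finType) (S : {set T}) (g : T -> T) :
  {in S &, injective g} -> exists s : {perm T}, {in S, s =1 g}.
Proof.
have [n] := ubnP #|S|; elim: n S => // n IHn S; rewrite ltnS => Sn injg.
have [->|[a aS]] := set_0Vmem S; first by exists 1%g => i; rewrite inE.
have [||s sg] := IHn (S :\ a).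
- by rewrite (leq_trans _ Sn)// [leqRHS](cardsD1 a) aS.
- by move=> i j /setD1P[_ iS] /setD1P[_ jS]; apply: injg.
(* Composing with the transposition of [s a] and [g a] corrects the value at [a]; the values at
   other points of [S] differ from both, by injectivity of [s] and of [g] on [S]. *)
exists (s * tperm (s a) (g a))%g => i; rewrite permM => iS.
have [->|ia] := eqVneq i a; first by rewrite tpermL.
have sgi : s i = g i by apply: sg; rewrite !inE ia.
rewrite tpermD ?sgi//; last by apply: contraNneq ia => /injg ->.
by rewrite -sgi (inj_eq perm_inj) eq_sym.
Qed.

(** Fix one extension [s] of [g]. The others are obtained by first applying a permutation that moves
    only points outside [S], so they form a coset of [perm_on (~: S)]. *)
Lemma card_perm_extension (T : finType) (S : {set T}) (g : T -> T) :
  {in S &, injective g} ->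
  #|[set s : {perm T} | [forall i in S, s i == g i]]| = (#|T| - #|S|)`!.
Proof.
move=> /perm_extension[s sg].
have -> : [set s : {perm T} | [forall i in S, s i == g i]] =
    [set (u * s)%g | u : {perm T} in perm_on (~: S)].
  apply/setP => u; rewrite inE; apply/forall_inP/imsetP.
    move=> ug; exists (u * s^-1)%g; last by rewrite mulgKV.
    apply/fintype.subsetP => i; rewrite !inE permM.
    by apply: contra => iS; rewrite (eqP (ug _ iS)) -sg// permK.
  case=> v /fintype.subsetP von -> i iS; rewrite permM.
  suff -> : v i = i by rewrite sg.
  by apply/eqP; apply: contraTT iS => /von; rewrite inE.
rewrite card_imset; last exact: mulIg.
by rewrite card_perm cardsCs finset.setCK.
Qed.

(** A diagonal entry of a power sums the weights of the walks returning to their start; a closed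
    walk is a function on the cyclically ordered indices. *)
Lemma mx_trace_exp (A : comNzRingType) (k n : nat) (M : 'M[A]_k.+1) :
  \tr (M ^+ n.+1) =
  \sum_(f : {ffun 'I_n.+1 -> 'I_k.+1}) \prod_i M (f i) (f (ordS i)).
Proof.
(* Weight of the walk from [a] through [s] to [b]: the default value of [nth], reached one place
   past the end of [s], supplies the endpoint [b]. *)
pose w a (s : seq 'I_k.+1) b :=
  \prod_(i < (size s).+1) M (nth b (a :: s) i) (nth b s i).
have wE m a b : (M ^+ m.+1) a b = \sum_(t : m.-tuple 'I_k.+1) w a t b.
  elim: m a => [|m IH] a.
    rewrite expr1 (big_pred1 [tuple]) => [|t]; last first.
      by apply/esym/eqP/val_inj; case: t => [[]].
    by rewrite /w big_ord1.
  rewrite exprS mxE.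
  pose h (t : 'I_k.+1 * m.-tuple 'I_k.+1) : m.+1.-tuple _ := [tuple of t.1 :: t.2].
  rewrite [RHS](reindex h) /=; last first.
    exists (fun t => (thead t, [tuple of behead t])) => [[x t] _|t _] /=.
      by congr pair; apply: val_inj.
    by rewrite [in RHS](tuple_eta t); apply: val_inj.
  rewrite -(pair_bigA _ (fun x t => w a (x :: tval t) b)) /=.
  apply: eq_bigr => x _; rewrite IH mulr_sumr; apply: eq_bigr => t _.
  by rewrite /w /= [RHS]big_ord_recl.
rewrite /mxtrace; under eq_bigr do rewrite wE.
pose h (t : 'I_k.+1 * n.-tuple 'I_k.+1) : {ffun 'I_n.+1 -> 'I_k.+1} :=
  [ffun i => tnth [tuple of t.1 :: t.2] i].
rewrite [RHS](reindex h) /=; last first.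
  exists (fun f => (f ord0, [tuple f (lift ord0 i) | i < n])) => [[x t] _|f _] /=.
    congr pair; first by rewrite ffunE.
    by apply: eq_from_tnth => i; rewrite tnth_mktuple ffunE tnthS.
  apply/ffunP => i; rewrite ffunE.
  by case: (unliftP ord0 i) => [j|] ->; rewrite ?tnthS ?tnth0 ?tnth_mktuple.
rewrite -(pair_bigA _ (fun x t => \prod_i M (h (x, t) i) (h (x, t) (ordS i)))) /=.
apply: eq_bigr => x _; apply: eq_bigr => t _.
rewrite /w size_tuple; apply: eq_bigr => i _; rewrite !ffunE /=.
rewrite !(tnth_nth x) /=; congr (M _ _).
(* At the last index [ordS] wraps to 0, whose state is [x], and the other side reads the default
   [x]. *)
have := ltn_ord i; rewrite ltnS leq_eqVlt => /predU1P[->|ilt].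
  by rewrite modnn /= nth_default// size_tuple.
by rewrite modn_small.
Qed.

(** * The functional t^k |-> k! and the transfer matrix *)

Definition poly_fact (R : nzRingType) (p : {poly R}) : R :=
  \sum_(k < size p) p`_k * k`!%:R.

Lemma poly_fact_widen (R : nzRingType) (p : {poly R}) n :
  (size p <= n)%N -> poly_fact p = \sum_(k < n) p`_k * k`!%:R.
Proof.
move=> pn; rewrite /poly_fact -(subnKC pn) big_split_ord /=.
rewrite [X in _ = _ + X]big1 ?addr0// => i _.
by rewrite nth_default ?mul0r// leq_addr.
Qed.

Lemma poly_fact_is_linear (R : nzRingType) : scalar (@poly_fact R).
Proof.
move=> a p q; pose n := maxn (size (a *: p + q)) (maxn (size p) (size q)).
rewrite !(@poly_fact_widen _ _ n) ?leq_max ?leqnn ?orbT//.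
rewrite mulr_sumr -big_split /=; apply: eq_bigr => i _.
by rewrite coefD coefZ mulrDl mulrA.
Qed.
HB.instance Definition _ (R : nzRingType) :=
  GRing.isLinear.Build R {poly R} R *%R (@poly_fact R) (@poly_fact_is_linear R).

Lemma poly_factXn (R : nzRingType) n : @poly_fact R 'X^n = n`!%:R.
Proof.
rewrite (@poly_fact_widen _ _ n.+1) ?size_polyXn// big_ord_recr /= big1 ?add0r.
  by rewrite coefXn eqxx mul1r.
by move=> i _; rewrite coefXn ltn_eqF ?mul0r.
Qed.

Section Transfer.
Variable R : comNzRingType.

(** The states are the choices at a position [i]: 0 imposes nothing and has weight ['X], 1 imposes
    [u i = i], 2 imposes [u i = i + 1], both with weight -1. A step from 2 to 1 is forbidden, as it
    would send [i] and [i + 1] both to [i + 1]. *)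
Definition menage_mx : 'M[{poly R}]_3 := \matrix_(a, b)
  ((if a == 0 then 'X else -1) * (~~ ((a == 2) && (b == 1)))%:R).

(** This is Cayley-Hamilton, checked entrywise; it gives the linear recurrence for the traces. *)
Lemma menage_mx3 : menage_mx ^+ 3 = ('X - 2) *: menage_mx ^+ 2 - menage_mx.
Proof.
apply/matrixP => a b; rewrite !(exprS, expr0, mulr1) !mxE.
rewrite !big_ord_recl !big_ord0 !mxE !big_ord_recl !big_ord0 !mxE.
by case: a => [[|[|[|a]]]]//= ?; case: b => [[|[|[|b]]]]//= ?; rewrite /eq_op /=; ring.
Qed.

Lemma trace_menage_mx1 : \tr menage_mx = 'X - 2.
Proof. by rewrite /mxtrace !big_ord_recl big_ord0 !mxE /eq_op /=; ring. Qed.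

Lemma trace_menage_mx2 : \tr (menage_mx ^+ 2) = ('X - 2) ^+ 2 - 2.
Proof.
rewrite expr2 /mxtrace !big_ord_recl big_ord0 !mxE !big_ord_recl !big_ord0 !mxE.
by rewrite /eq_op /=; ring.
Qed.

Lemma trace_menage_mxSS n :
  \tr (menage_mx ^+ n.+3) =
  ('X - 2) * \tr (menage_mx ^+ n.+2) - \tr (menage_mx ^+ n.+1).
Proof.
rewrite -(addn3 n) exprD menage_mx3 mulrBr -scalerAr -exprD -exprSr addn2.
by rewrite raddfB /= mxtraceZ.
Qed.
End Transfer.

Lemma natr_forall (R : comNzRingType) (I : finType) (P b : pred I) :
  [forall (i | P i), b i]%:R = \prod_(i | P i) (b i)%:R :> R.
Proof.
have [/forall_inP bP|/forall_inPn[i Pi /negbTE bi]] := boolP [forall (i | P i), b i].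
  by rewrite big1// => i /bP ->.
by rewrite (bigD1 i)//= bi mul0r.
Qed.

Definition menage_perm n (s : 'S_n) :=
  [forall i, (s i != i) && (s i != ordS i)].

Lemma ordS_neq n (i : 'I_n) : (1 < n)%N -> ordS i != i.
Proof.
case: n i => // n i n1; apply/eqP => /(congr1 val) /=.
have := ltn_ord i; rewrite ltnS leq_eqVlt => /predU1P[->|ilt].
  by rewrite modnn => n0; rewrite -n0 in n1.
by rewrite modn_small// => /esym /n_Sn.
Qed.

Lemma card_menage_perm (R : comNzRingType) n : (1 < n)%N ->
  #|[set s : 'S_n | menage_perm s]|%:R = poly_fact (\tr (menage_mx R ^+ n)).
Proof.
case: n => // n n1.
(* The summand selected by the choice [a] in the factor 1 - [s i = i] - [s i = i + 1]. *)
pose c (s : 'S_n.+1) (a : 'I_3) i : R := if a == 0 then 1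
  else - (s i == if a == 1 then i else ordS i)%:R.
have permE s : (menage_perm s)%:R = \prod_i \sum_a c s a i.
  have -> : menage_perm s = [forall (i | true), (s i != i) && (s i != ordS i)] by [].
  rewrite natr_forall; apply: eq_bigr => i _.
  rewrite !big_ord_recl big_ord0 /c [_ == 0]eqxx /= addr0.
  (* The two forbidden values are distinct, so the factor is 0 or 1 and never -1. *)
  have iS : (i == ordS i) = false by rewrite eq_sym; exact/negbTE/ordS_neq.
  have [->|_] := eqVneq (s i) i; first by rewrite iS /=; ring.
  by case: (_ == _) => /=; ring.
rewrite cardsE -sum1_card natr_sum big_mkcond /=.
have toprod (s : 'S_n.+1) : true ->
    (if s \in menage_perm (n:=n.+1) then 1 else 0) =
    \sum_(f : {ffun 'I_n.+1 -> 'I_3}) \prod_i c s (f i) i :> R.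
  by move=> _; rewrite -(bigA_distr_bigA (fun i a => c s a i)) -permE
    -[_ \in _]/(menage_perm s); case: menage_perm.
rewrite (eq_bigr _ toprod) exchange_big /= mx_trace_exp linear_sum /=.
apply: eq_bigr => f _.
(* [S] collects the positions constrained by the choices [f], and [g] the values prescribed
   there. *)
pose S := [set i | f i != 0].
pose g i := if f i == 1 then i else ordS i.
have cE s : true -> \prod_i c s (f i) i =
    (-1) ^+ #|S| * [forall i in S, s i == g i]%:R.
  move=> _; rewrite (bigID (mem S)) /= [X in _ * X]big1 ?mulr1; last first.
    by move=> i; rewrite inE negbK /c => ->.
  rewrite natr_forall -prodrN; apply: eq_bigr => i.
  by rewrite inE /c => /negPf ->.
rewrite (eq_bigr _ cE) -mulr_sumr -natr_sum.
have -> : (\sum_(s : 'S_n.+1) [forall i in S, s i == g i] =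
    #|[set s : 'S_n.+1 | [forall i in S, s i == g i]]|)%N.
  by rewrite cardsE -sum1_card [RHS]big_mkcond.
(* The closed walk [f] weighs (-1)^|S| t^(n - |S|), with n the number of positions, or 0 if it makes
   a step from 2 to 1. *)
have -> : \prod_i menage_mx R (f i) (f (ordS i)) =
    ((-1) ^+ #|S| *: 'X^(n.+1 - #|S|))
      *+ [forall i, ~~ ((f i == 2) && (f (ordS i) == 1))].
  under eq_bigr do rewrite mxE.
  rewrite big_split /= -(natr_forall _ predT) mulr_natr; congr (_ *+ _).
  rewrite (bigID (mem S)) /= -mul_polyC rmorphXn rmorphN1; congr (_ * _).
    rewrite -[RHS]prodr_const; apply: eq_bigr => i.
    by rewrite inE => /negPf ->.
  have -> : (n.+1 - #|S| = #|~: S|)%N by rewrite [RHS]cardsCs finset.setCK card_ord.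
  rewrite -prodr_const; apply: eq_big => i; first by rewrite [in RHS]inE.
  by rewrite inE negbK => ->.
rewrite raddfMn /= linearZ /= poly_factXn -mulrnAr -mulrnA; congr (_ * _%:R).
(* A forbidden step prescribes one value at two consecutive positions, so no permutation fits.
   Without such a step [g] is injective on [S], since a collision would need choice 2 at some [i]
   and choice 1 at [ordS i]. *)
case: (boolP [forall i, ~~ ((f i == 2) && (f (ordS i) == 1))]) => [fP|]; last first.
  move=> /fintype.forallPn[i0]; rewrite negbK => /andP[fi fSi].
  rewrite muln0; apply: eq_card0 => s; rewrite inE.
  apply/negbTE/negP => /forall_inP sg.
  have siS : s i0 = s (ordS i0).
    rewrite (eqP (sg i0 _)) ?inE ?(eqP fi)// (eqP (sg (ordS i0) _)) ?inE ?(eqP fSi)//.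
    by rewrite /g fSi (eqP fi).
  by have := ordS_neq i0 n1; rewrite -(inj_eq (@perm_inj _ s)) siS eqxx.
rewrite muln1 card_perm_extension ?card_ord//.
have f2 i : i \in S -> f i != 1 -> f i == 2.
  by rewrite inE; case: (f i) => [[|[|[|]]]].
have gN i j : i \in S -> f i != 1 -> f j == 1 -> g i != g j.
  move=> iS fi1 fj1; rewrite /g fj1 (negPf fi1); apply/eqP => ij.
  by have := forallP fP i; rewrite (f2 _ iS fi1) ij fj1.
move=> i j iS jS; have [fi1|fi1] := eqVneq (f i) 1; have [fj1|fj1] := eqVneq (f j) 1.
- by rewrite /g fi1 fj1.
- by move/eqP; rewrite eq_sym (negPf (gN _ _ _ _ _)) ?fi1.
- by move/eqP; rewrite (negPf (gN _ _ _ _ _)) ?fj1.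
- by rewrite /g (negPf fi1) (negPf fj1); apply: ordS_inj.
Qed.

(** * Seatings and permutations of the couples *)

Section Seatings.
Variable n : nat.

Fact seat_index_subproof (i : 'I_n.*2) : (i./2 < n)%N.
Proof. by rewrite ltn_half_double. Qed.
Definition seat_index (i : 'I_n.*2) : 'I_n := Ordinal (seat_index_subproof i).

Fact seat_subproof (b : bool) (j : 'I_n) : (b + j.*2 < n.*2)%N.
Proof. by have := ltn_ord j; case: b; lia. Qed.
(** Even and odd seats are numbered separately. The odd seat [j] lies between the even seats [j] and
    [ordS j]; these are the two values that [menage_perm] excludes. *)
Definition seat b j : 'I_n.*2 := Ordinal (seat_subproof b j).

Lemma odd_seat b j : odd (seat b j) = b.
Proof. by rewrite /= oddD odd_double addbF oddb. Qed.

Lemma seat_indexK b j : seat_index (seat b j) = j.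
Proof. by apply: val_inj; rewrite /= half_bit_double. Qed.

Lemma seatK (i : 'I_n.*2) : seat (odd i) (seat_index i) = i.
Proof. by apply: val_inj; rewrite /= odd_double_half. Qed.

Lemma ordS_seat0 j : ordS (seat false j) = seat true j.
Proof. by apply: val_inj; rewrite /= modn_small//; have := ltn_ord j; lia. Qed.

Lemma ordS_seat1 j : ordS (seat true j) = seat false (ordS j).
Proof.
apply: val_inj => /=; have := ltn_ord j.
rewrite leq_eqVlt => /predU1P[jn|jn].
  by rewrite add0n jn -doubleS jn !modnn.
by rewrite !modn_small//; lia.
Qed.

(* The seats [2j] go to one sex, along [p]; the person in seat [2j + 1] is the
   spouse of the one in seat [2 (u j)]. *)
Definition seating_of (x : bool * 'S_n * 'S_n) : {ffun 'I_n.*2 -> 'I_n * bool} :=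
  let: (c, p, u) := x in
  [ffun i : 'I_n.*2 =>
    (p (if odd i then u (seat_index i) else seat_index i), c (+) odd i)].

Lemma seating_ofE c p u b j :
  seating_of (c, p, u) (seat b j) = (p (if b then u j else j), c (+) b).
Proof. by rewrite ffunE odd_seat seat_indexK. Qed.

(** The even seats determine [p], one of them determines [c], and the odd seats then determine
    [u]. *)
Lemma seating_of_inj : (0 < n)%N -> injective seating_of.
Proof.
move=> n0 [[c p] u] [[c' p'] u'] /ffunP E.
have Eb b j := E (seat b j); have pp : p = p'.
  by apply/permP => j; have := Eb false j; rewrite !seating_ofE => -[].
have -> : c = c'.
  by have := Eb false (Ordinal n0); rewrite !seating_ofE !addbF => -[].
congr (_, _, _) => //; apply/permP => j.
by have := Eb true j; rewrite !seating_ofE pp => -[/perm_inj].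
Qed.

Lemma menage_seating_of c p u : menage_perm u -> menage_seating (seating_of (c, p, u)).
Proof.
move=> /forallP uP; apply/and3P; split.
- apply/injectiveP => i j; rewrite -(seatK i) -(seatK j) !seating_ofE.
  case=> pij /addbI oij; move: pij; rewrite -oij => /perm_inj.
  by case: odd => [/perm_inj|] ->.
- apply/forallP => i; rewrite -(seatK i); case: odd.
    by rewrite ordS_seat1 !seating_ofE /= (inj_eq (@addbI _)).
  by rewrite ordS_seat0 !seating_ofE /= (inj_eq (@addbI _)).
- apply/forallP => i; rewrite -(seatK i); have /andP[u0 u1] := uP (seat_index i).
  case: odd.
    by rewrite ordS_seat1 !seating_ofE /= (inj_eq perm_inj).
  by rewrite ordS_seat0 !seating_ofE /= (inj_eq perm_inj) eq_sym.
Qed.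

Lemma menage_seatingP s : (0 < n)%N -> menage_seating s ->
  exists c p u, menage_perm u /\ s = seating_of (c, p, u).
Proof.
move=> n0 /and3P[/injectiveP sinj /forallP salt /forallP sneq].
pose c := (s (seat false (Ordinal n0))).2.
(* Alternation propagates the sex of seat 0 along the table. *)
have s2 k (kn : (k < n.*2)%N) : (s (Ordinal kn)).2 = c (+) odd k.
  elim: k kn => [|k IH] kn.
    by rewrite addbF /c; congr (s _).2; apply: val_inj.
  have := salt (Ordinal (ltnW kn)); rewrite IH.
  have -> : ordS (Ordinal (ltnW kn)) = Ordinal kn.
    by apply: val_inj; rewrite /= modn_small.
  by rewrite /=; case: (c); case: odd; case: (s _).2.
have {}s2 b j : (s (seat b j)).2 = c (+) b.
  by rewrite s2 -[X in odd X]/(val (seat b j)) odd_seat.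
(* Seats of equal parity hold one sex, so there the couple identifies the person. *)
have s1_inj b : injective (fun j => (s (seat b j)).1).
  move=> i j /= ij; rewrite -(seat_indexK b i) -(seat_indexK b j).
  congr seat_index; apply: sinj.
  by rewrite [LHS]surjective_pairing [RHS]surjective_pairing ij !s2.
pose p := perm (s1_inj false); pose q := perm (s1_inj true).
(* This product applies [q] first: it sends [j] to the even seat of the spouse of the person in the
   odd seat [j]. *)
exists c, p, (q * p^-1)%g; split.
  apply/forallP => j; rewrite !permM !(canF_eq (permKV p)) !permE.
  have := sneq (seat false j); have := sneq (seat true j).
  by rewrite ordS_seat0 ordS_seat1 => -> /=; rewrite eq_sym => ->.
apply/ffunP => i; rewrite -(seatK i) seating_ofE; move: (odd i) (seat_index i).
move=> b j; rewrite [LHS]surjective_pairing s2; congr pair.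
by case: b; rewrite ?permM ?permKV permE.
Qed.

End Seatings.

Lemma menage_card n : (0 < n)%N ->
  menage n = (2 * n`! * #|[set s : 'S_n | menage_perm s]|)%N.
Proof.
move=> n0; pose U := [set s : 'S_n | menage_perm s].
rewrite /menage.
transitivity #|[set seating_of x | x in finset.setX [set: bool * 'S_n] U]|.
  apply: eq_card => s; apply/idP/imsetP.
    move=> /set_mem /(menage_seatingP n0)[c [p [u [uP ->]]]].
    by exists (c, p, u); rewrite // !inE.
  by case=> [[[c p] u]]; rewrite !inE /= => uP ->; exact: menage_seating_of.
rewrite card_imset; last exact: seating_of_inj.
by rewrite cardsX cardsT card_prod card_bool card_Sn.
Qed.

(** * Formal power series *)

Lemma fps_coefMn (A : zmodType) (f : fps A) k n :
  fps_coef (f *+ k) n = fps_coef f n *+ k.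
Proof. by elim: k => [|k IH]; rewrite ?mulr0n// !mulrS fps_coefD IH. Qed.

Lemma fps_coefM_eql (A : comNzRingType) (f g h : fps A) n :
  (forall i, (i <= n)%N -> fps_coef g i = fps_coef h i) ->
  fps_coef (f * g) n = fps_coef (f * h) n.
Proof. by move=> gh; apply: eq_bigr => i _; rewrite gh// leq_subr. Qed.

Lemma fps_coefXM0 (A : comNzRingType) (f : fps A) : fps_coef (fpsX A * f) 0 = 0.
Proof. by rewrite fps_coefM big_ord1 mul0r. Qed.

Lemma fps_coefXMS (A : comNzRingType) (f : fps A) n :
  fps_coef (fpsX A * f) n.+1 = fps_coef f n.
Proof.
rewrite fps_coefM !big_ord_recl big1 ?addr0 ?mul0r ?add0r ?mul1r ?subSS ?subn0//.
by move=> i _; rewrite mul0r.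
Qed.

Lemma fps_coefCM (A : comNzRingType) (a : A) (f : fps A) n :
  fps_coef (fpsC a * f) n = a * fps_coef f n.
Proof.
by rewrite fps_coefM big_ord_recl subn0 big1 ?addr0// => i _; rewrite mul0r.
Qed.

Lemma fpsC_is_monoid_morphism (A : comNzRingType) : monoid_morphism (@fpsC A).
Proof.
split=> [|a b]; apply: fpsP => n; first by case: n.
by rewrite fps_coefCM; case: n => //= n; rewrite mulr0.
Qed.
Lemma fpsC_is_zmod_morphism (A : comNzRingType) : zmod_morphism (@fpsC A).
Proof. by move=> a b; apply: fpsP => -[|n] //=; rewrite subrr. Qed.
HB.instance Definition _ (A : comNzRingType) :=
  GRing.isZmodMorphism.Build A (fps A) (@fpsC A) (@fpsC_is_zmod_morphism A).
HB.instance Definition _ (A : comNzRingType) :=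
  GRing.isMonoidMorphism.Build A (fps A) (@fpsC A) (@fpsC_is_monoid_morphism A).

Lemma fps_unitE (A : comUnitRingType) (f : fps A) :
  (f \is a GRing.unit) = (fps_coef f 0 \is a GRing.unit).
Proof. by []. Qed.

Lemma fps_onePX_unit (A : comUnitRingType) : 1 + fpsX A \is a GRing.unit.
Proof. by rewrite fps_unitE fps_coefD fps_coef1 addr0 unitr1. Qed.

Section FpsMap.
Variables (A B : comNzRingType) (h : {rmorphism A -> B}).

Definition fps_map (f : fps A) : fps B := Fps (fun n => h (fps_coef f n)).

Lemma fps_map_is_zmod_morphism : zmod_morphism fps_map.
Proof. by move=> f g; apply: fpsP => n; rewrite /= rmorphB. Qed.
Lemma fps_map_is_monoid_morphism : monoid_morphism fps_map.
Proof.
split=> [|f g]; apply: fpsP => n /=; first by rewrite rmorph_nat.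
by rewrite rmorph_sum; apply: eq_bigr => i _; rewrite rmorphM.
Qed.
HB.instance Definition _ :=
  GRing.isZmodMorphism.Build (fps A) (fps B) fps_map fps_map_is_zmod_morphism.
HB.instance Definition _ :=
  GRing.isMonoidMorphism.Build (fps A) (fps B) fps_map fps_map_is_monoid_morphism.

Lemma fps_mapX : fps_map (fpsX A) = fpsX B.
Proof. by apply: fpsP => n; rewrite /= rmorph_nat. Qed.
End FpsMap.

(** As [F k] has order at least [k], the terms with [k > n] do not reach the coefficients up to
    [n]. *)
Lemma fps_coef_fps_sum (A : zmodType) (F : nat -> fps A) n i :
  (forall k j, (j < k)%N -> fps_coef (F k) j = 0) -> (i <= n)%N ->
  fps_coef (fps_sum F) i = fps_coef (\sum_(k < n.+1) F k) i.
Proof.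
move=> F0 ni; rewrite fps_coef_sum /= (@fsbig_ord _ _ _ n.+1 (fun k => fps_coef (F k) i)).
symmetry; apply: fsbig_widen => // k [_ /= /negP].
by rewrite -leqNgt => nk; apply: F0; rewrite (leq_trans _ nk).
Qed.

(** * The generating series of the traces *)

Section MenageSeries.
Variable R : fieldType.
Let x := fpsX {poly R}.
Let t : fps {poly R} := fpsC 'X.

(** The constant coefficient is that of the rational function in [menage_seriesE]; the trace of the
    identity matrix would be 3. *)
Definition menage_series : fps {poly R} :=
  Fps (fun n => if n is 0 then 1 else \tr (menage_mx R ^+ n)).

Lemma menage_denom_unit : x * t - (x + 1) ^+ 2 \is a GRing.unit.
Proof.
have c0 : fps_coef (x * t - (x + 1) ^+ 2) 0 = -1.
  rewrite fps_coefD fps_coefN expr2 fps_coefXM0.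
  by rewrite fps_coefM big_ord1 fps_coefD fps_coef1 !add0r mulr1.
by rewrite fps_unitE c0 unitrN1.
Qed.

(** After clearing the denominator, degrees 3 and up are the trace recurrence; the lower degrees are
    checked from the first two traces. *)
Lemma menage_seriesE : (x ^+ 2 - 1) / (x * t - (x + 1) ^+ 2) = menage_series.
Proof.
apply: (canLR (mulrK menage_denom_unit)).
have -> : menage_series * (x * t - (x + 1) ^+ 2) =
    x * (t * menage_series) - x * (x * menage_series)
    - (x * menage_series) *+ 2 - menage_series.
  by ring.
apply: fpsP => n; rewrite expr2 !fps_coefD !fps_coefN fps_coefMn fps_coef1.
case: n => [|[|[|n]]];
  rewrite !(fps_coefXM0, fps_coefXMS) ?fps_coefCM /=.
- by ring.
- by rewrite expr1 trace_menage_mx1; ring.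
- by rewrite expr1 trace_menage_mx1 trace_menage_mx2; ring.
- by rewrite trace_menage_mxSS; ring.
Qed.

(** The algebraic form of [laplace], with the integrals replaced by their values k!; see
    [laplaceE]. *)
Definition fps_laplace (g : fps {poly R}) : fps R :=
  Fps (fun n => poly_fact (fps_coef g n)).

Definition fps_fact_sum : fps R := let x := fpsX R in
  fps_sum (fun k => k`!%:R * x ^+ k / (1 + x) ^+ (2 * k)).

Let y := fpsX R / (1 + fpsX R) ^+ 2.

Lemma fps_fact_sum_coef n i : (i <= n)%N ->
  fps_coef fps_fact_sum i = fps_coef (\sum_(k < n.+1) k`!%:R * y ^+ k) i.
Proof.
have FE k : k`!%:R * fpsX R ^+ k / (1 + fpsX R) ^+ (2 * k) = k`!%:R * y ^+ k.
  by rewrite -mulrA /y expr_div_n exprM.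
move=> ni; rewrite (fps_coef_fps_sum _ ni)//.
  by rewrite !fps_coef_sum; apply: eq_bigr => k _; rewrite FE.
move=> k j jk; rewrite FE mulr_natl fps_coefMn fps_coefX_small ?mul0rn//.
by rewrite /y fps_coefXM0.
Qed.

(** With y = x / (1 + x)^2 and a = (1 - x) / (1 + x), the series is a / (1 - t y). It expands into
    the sum of the a y^k t^k, and t^k becomes k!. *)
Lemma fps_laplace_menage : fps_laplace menage_series =
  ((1 - fpsX R) / (1 + fpsX R)) * fps_fact_sum.
Proof.
pose a := (1 - fpsX R) / (1 + fpsX R).
pose io : {rmorphism fps R -> fps {poly R}} := fps_map polyC.
have ioX : io (fpsX R) = x by exact: fps_mapX.
have geom : menage_series * (1 - t * io y) = io a.
  (* Writing [v] for the inverse of 1 + x, and inserting powers of v (1 + x) = 1, reduces the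
     identities to polynomial ones. *)
  pose v := io (1 + fpsX R)^-1.
  have v1 : v * (1 + x) = 1.
    have -> : 1 + x = io (1 + fpsX R) by rewrite rmorphD rmorph1 ioX.
    by rewrite -rmorphM mulVr ?rmorph1 ?fps_onePX_unit.
  have -> : io y = x * v ^+ 2.
    by rewrite /y -exprVn rmorphM rmorphXn ioX.
  have -> : io a = (1 - x) * v.
    by rewrite /a rmorphM rmorphB rmorph1 ioX.
  transitivity (v ^+ 2 * (1 - x) * (1 + x)); last first.
    by rewrite -[RHS]mul1r -[X in _ = X * _]v1; ring.
  rewrite -menage_seriesE.
  transitivity ((x ^+ 2 - 1) / (x * t - (x + 1) ^+ 2) *
      v ^+ 2 * - (x * t - (x + 1) ^+ 2)).
    have v2 : v ^+ 2 * (1 + x) ^+ 2 = 1 by rewrite -exprMn v1 expr1n.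
    by rewrite -[X in X - t * _]v2; ring.
  rewrite mulrN mulrAC divrK ?menage_denom_unit//; ring.
apply: fpsP => n; rewrite (fps_coefM_eql _ (fun i => @fps_fact_sum_coef n i)).
(* Finite geometric sum with remainder; as [y] has no constant term, the remainder has order above
   [n]. *)
have gE : menage_series = io a * (\sum_(k < n.+1) (t * io y) ^+ k) +
    menage_series * (t * io y) ^+ n.+1.
  rewrite -geom -mulrA.
  have := subrXX 1 (t * io y) n.+1; rewrite expr1n.
  under eq_bigr do rewrite expr1n mul1r.
  by move=> <-; ring.
rewrite mulr_sumr fps_coef_sum -[LHS]/(poly_fact (fps_coef _ n)).
rewrite {1}gE fps_coefD.
rewrite [X in _ + X](_ : _ = 0) ?addr0; last first.
  rewrite fps_coefM big1// => i _; rewrite fps_coefX_small ?mulr0//.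
    rewrite fps_coefCM -[fps_coef (io y) 0]/((fps_coef y 0)%:P).
    by rewrite /y fps_coefXM0 mulr0.
  by rewrite ltnS leq_subr.
rewrite mulr_sumr fps_coef_sum linear_sum; apply: eq_bigr => k _.
have -> : io a * (t * io y) ^+ k = fpsC 'X^k * io (a * y ^+ k).
  by rewrite exprMn mulrCA [io (a * _)]rmorphM (rmorphXn io) (rmorphXn (@fpsC _)).
rewrite fps_coefCM -[fps_coef (io _) n]/((fps_coef _ n)%:P) mulrC mul_polyC.
rewrite [in RHS]mulrCA mulr_natl fps_coefMn -mulr_natr linearZ.
by rewrite -[LHS]/(_ * poly_fact _) poly_factXn.
Qed.

End MenageSeries.

(** * Integrals against the exponential *)

Section RealTools.
Variable R : realType.
Local Notation mu := (@lebesgue_measure R).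
Local Open Scope classical_set_scope.

Lemma is_derive_le (f df : R -> R) (a b : R) : a <= b ->
  (forall x, a <= x <= b -> is_derive x 1 f (df x)) ->
  (forall x, a <= x <= b -> 0 <= df x) -> f a <= f b.
Proof.
move=> ab fdf df0.
have [x||c cab fab] := @MVT_segment R f df a b ab.
- by move=> /subset_itv_oo_cc; rewrite in_itv; exact: fdf.
- apply: derivable_within_continuous => x; rewrite in_itv /= => axb.
  by have [] := fdf x axb.
by rewrite -subr_ge0 fab mulr_ge0 ?subr_ge0// df0; rewrite ?in_itv in cab.
Qed.

Lemma is_derive1_cvg (f : R -> R) (x d : R) : is_derive x 1 f d ->
  f y @[y --> x] --> f x.
Proof. by case=> fx _; apply/differentiable_continuous/derivable1_diffP. Qed.

(** From e^t >= t^(k+1) / (k+1)! for t > 0, the function is at most (k+1)! / t. *)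
Lemma cvg_expMexpN k : t ^+ k * expR (- t) @[t --> +oo%R] --> (0 : R).
Proof.
have inv0 : (k.+1)`!%:R * t^-1 @[t --> +oo%R] --> (0 : R).
  rewrite -[X in _ --> X](mulr0 (k.+1)`!%:R); apply: cvgMr.
  apply/gtr0_cvgV0; last exact: cvg_id.
  by apply: nbhs_pinfty_gt; exact: num_real.
apply: (squeeze_cvgr _ (cvg_cst 0) inv0).
near=> t.
have t0 : 0 < t by near: t; apply: nbhs_pinfty_gt; exact: num_real.
rewrite mulr_ge0 ?exprn_ge0 ?expR_ge0 ?(ltW t0)//= expRN.
rewrite ler_pdivlMr// mulrAC -exprSr ler_pdivrMr ?expR_gt0//.
rewrite -ler_pdivrMl ?ltr0n ?fact_gt0// mulrC.
by rewrite (le_trans _ (expR_ge1Dxn k (ltW t0)))// lerDr.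
Unshelve. all: by end_near. Qed.


Section DeriveTools.
Variables (f g : R -> R) (x df dg : R).
Hypotheses (Hf : is_derive x 1 f df) (Hg : is_derive x 1 g dg).

Lemma is_derive1D : is_derive x 1 (fun t => f t + g t) (df + dg).
Proof. exact: is_deriveD. Qed.
Lemma is_derive1B : is_derive x 1 (fun t => f t - g t) (df - dg).
Proof. exact: is_deriveB. Qed.
Lemma is_derive1N : is_derive x 1 (fun t => - f t) (- df).
Proof. exact: is_deriveN. Qed.
Lemma is_derive1M : is_derive x 1 (fun t => f t * g t) (f x * dg + g x * df).
Proof. exact: is_deriveM. Qed.
Lemma is_derive1Ml c : is_derive x 1 (fun t => c * f t) (c * df).
Proof. exact: is_deriveZ. Qed.
Lemma is_derive1X n : is_derive x 1 (fun t => f t ^+ n) (n%:R * f x ^+ n.-1 * df).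
Proof.
have -> : (fun t => f t ^+ n) = f ^+ n by apply/funext => t; rewrite exprfctE.
exact: is_deriveX.
Qed.
Lemma is_derive1V : f x != 0 -> is_derive x 1 (fun t => (f t)^-1) (- (f x) ^- 2 * df).
Proof. by move=> fx; exact: is_deriveV. Qed.
End DeriveTools.

Lemma is_derive_expN (x : R) : is_derive x 1 (fun t => expR (- t)) (- expR (- x)).
Proof. by apply: is_derive_eq; rewrite mulrN1. Qed.

(** Antiderivative of t^k e^(-t) obtained by repeated integration by parts. *)
Fixpoint expM_primitive k (t : R) : R :=
  if k is k'.+1 then k%:R * expM_primitive k' t - t ^+ k * expR (- t)
  else - expR (- t).

Lemma is_derive_expM_primitive k (x : R) :
  is_derive x 1 (expM_primitive k) (x ^+ k * expR (- x)).
Proof.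
elim: k => [|k IH].
  by rewrite expr0 mul1r -[expR _]opprK; apply/is_derive1N/is_derive_expN.
have XM := is_derive1M (is_derive1X (is_derive_id x 1) k.+1) (is_derive_expN x).
apply: is_derive_eq (is_derive1B (is_derive1Ml IH k.+1%:R) XM) _.
by rewrite /=; ring.
Qed.

Lemma expM_primitive0 k : expM_primitive k 0 = - k`!%:R.
Proof.
elim: k => [|k IH] /=; first by rewrite oppr0 expR0.
by rewrite IH expr0n mul0r subr0 factS natrM mulrN.
Qed.

Lemma cvg_expM_primitive k : expM_primitive k t @[t --> +oo%R] --> (0 : R).
Proof.
elim: k => [|k IH].
  rewrite -[X in _ --> X]oppr0; apply: cvgN.
  have := cvg_expMexpN 0; by under eq_fun do rewrite expr0 mul1r.
rewrite -[X in _ --> X]subr0 -[X in _ --> X - _](mulr0 k.+1%:R).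
by apply: cvgB; [exact: cvgMr|exact: cvg_expMexpN].
Qed.

Lemma integral_expMexpN k :
  (\int[mu]_(t in `[0%R, +oo[) (t ^+ k * expR (- t))%:E = (k`!%:R)%:E)%E.
Proof.
have D := is_derive_expM_primitive k.
rewrite (@ge0_continuous_FTC2y R _ (expM_primitive k) 0 0).
- by rewrite expM_primitive0 sub0e EFinN oppeK.
- by move=> x x0; rewrite mulr_ge0 ?exprn_ge0 ?expR_ge0.
- apply: continuous_subspaceT => x; apply: cvgM; first exact: exprn_continuous.
  exact: is_derive1_cvg (is_derive_expN x).
- exact: cvg_expM_primitive.
- by move=> x _; have [] := D x.
- by apply: cvg_at_right_filter; exact: is_derive1_cvg (D 0).
- by move=> x _; rewrite derive1E; have [_] := D x.
Qed.

Lemma integrable_expMexpN k :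
  mu.-integrable `[0, +oo[ (EFin \o (fun t : R => t ^+ k * expR (- t))).
Proof.
apply/integrableP; split.
  apply/measurable_EFinP; apply: measurable_funTS.
  apply: continuous_measurable_fun => x.
  apply: cvgM; first exact: exprn_continuous.
  exact: is_derive1_cvg (is_derive_expN x).
apply: (@le_lt_trans _ _ (k`!%:R)%:E); last exact: ltry.
rewrite -integral_expMexpN le_eqVlt; apply/orP; left; apply/eqP.
apply: eq_integral => t; rewrite inE /= in_itv /= andbT => t0.
by rewrite /= ger0_norm ?mulr_ge0 ?exprn_ge0 ?expR_ge0.
Qed.

Lemma Rintegral_expMexpN k :
  \int[mu]_(t in `[0, +oo[) (t ^+ k * expR (- t)) = k`!%:R.
Proof. by rewrite /Rintegral integral_expMexpN. Qed.

(** Integrability and value are proved in one induction over the monomials, because additivity of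
    the integral asks for integrability of both summands. *)
Lemma integrable_hornerexpN (p : {poly R}) :
  mu.-integrable `[0, +oo[ (EFin \o (fun t : R => p.[t] * expR (- t))) /\
  \int[mu]_(t in `[0, +oo[) (p.[t] * expR (- t)) = poly_fact p.
Proof.
pose I q := mu.-integrable `[0, +oo[ (EFin \o (fun t : R => q.[t] * expR (- t))) /\
  \int[mu]_(t in `[0, +oo[) (q.[t] * expR (- t)) = poly_fact q.
rewrite -/(I p) -[p]coefK poly_def.
have IZ a k : I (a *: 'X^k).
  have eqZ : (fun t : R => (a *: 'X^k).[t] * expR (- t)) =
      (fun t => a * (t ^+ k * expR (- t))).
    by apply/funext => t; rewrite hornerZ hornerXn mulrA.
  rewrite /I eqZ linearZ /= poly_factXn RintegralZl// ?Rintegral_expMexpN.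
    split=> //; apply: eq_integrable (integrableZl _ a (integrable_expMexpN k)) => //.
  exact: integrable_expMexpN.
elim/big_ind : _ => [|q r [qi qI] [ri rI]|i _]; last exact: IZ.
  by rewrite -(scale0r 'X^0).
have eqD : (fun t : R => (q + r).[t] * expR (- t)) =
    (fun t => q.[t] * expR (- t) + r.[t] * expR (- t)).
  by apply/funext => t; rewrite hornerD mulrDl.
rewrite /I eqD raddfD /= -qI -rI RintegralD//; split=> //.
by apply: eq_integrable (integrableD _ qi ri).
Qed.

Lemma Rintegral_hornerexpN (p : {poly R}) :
  \int[mu]_(t in `[0, +oo[) (p.[t] * expR (- t)) = poly_fact p.
Proof. exact: (integrable_hornerexpN p).2. Qed.

Lemma laplaceE (g : fps {poly R}) : laplace g = Fps (fun n => poly_fact (fps_coef g n)).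
Proof.
apply: fpsP => n; apply: eq_bigr => k _.
by rewrite -Rintegral_expMexpN.
Qed.

End RealTools.

(** * The integral formula for the menage numbers *)

Section MenageIntegral.
Variable R : realType.
Local Open Scope complex_scope.
Local Open Scope classical_set_scope.

Lemma menage_poly_factE n : (1 < n)%N ->
  (menage n)%:R = 2 * n`!%:R * poly_fact (\tr (menage_mx R ^+ n)) :> R.
Proof. by move=> n1; rewrite menage_card ?(ltnW n1)// !natrM card_menage_perm. Qed.

(** The power sums of [a] and [b] obey the recurrence of the traces, with the same first two values.
    The exponent is positive so that the third eigenvalue 0 contributes nothing. *)
Lemma trace_menage_mx_horner n (a b : R[i]) (t : R) :
  a + b = (t - 2)%:C -> a * b = 1 ->
  a ^+ n.+1 + b ^+ n.+1 = (\tr (menage_mx R ^+ n.+1)).[t]%:C.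
Proof.
move=> sab pab.
suff : (a ^+ n.+1 + b ^+ n.+1 = (\tr (menage_mx R ^+ n.+1)).[t]%:C) /\
       (a ^+ n.+2 + b ^+ n.+2 = (\tr (menage_mx R ^+ n.+2)).[t]%:C) by case.
elim: n => [|n [IH1 IH2]]; [split|split=> //].
- by rewrite !expr1 trace_menage_mx1 !hornerE.
- have -> : a ^+ 2 + b ^+ 2 = (a + b) ^+ 2 - 2 * (a * b) by ring.
  rewrite sab pab mulr1 -(rmorph_nat (real_complex R)) -rmorphXn -rmorphB.
  by rewrite trace_menage_mx2 !hornerE.
have -> : a ^+ n.+3 + b ^+ n.+3 =
    (a + b) * (a ^+ n.+2 + b ^+ n.+2) - a * b * (a ^+ n.+1 + b ^+ n.+1).
  by rewrite !exprS; ring.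
by rewrite sab pab mul1r IH1 IH2 -rmorphM -rmorphB trace_menage_mxSS !hornerE.
Qed.

Lemma menage_Cintegral n : (1 < n)%N ->
  (menage n)%:R = 2 * n`!%:R *
    Cintegral `[0, +oo[ (fun t : R =>
      ((((t - 2)%:C + sqrtC (t ^+ 2 - 4 * t)%:C) / 2) ^+ n +
       (((t - 2)%:C - sqrtC (t ^+ 2 - 4 * t)%:C) / 2) ^+ n) *
      (expR (- t))%:C) :> R[i].
Proof.
move=> n1; pose q := \tr (menage_mx R ^+ n).
have fE : (fun t : R =>
      ((((t - 2)%:C + sqrtC (t ^+ 2 - 4 * t)%:C) / 2) ^+ n +
       (((t - 2)%:C - sqrtC (t ^+ 2 - 4 * t)%:C) / 2) ^+ n) *
      (expR (- t))%:C) = (fun t => (q.[t] * expR (- t))%:C).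
  apply/funext => t; rewrite rmorphM; congr (_ * _).
  have two0 : (2 : R[i]) != 0 by rewrite pnatr_eq0.
  rewrite /q -(prednK (ltnW n1)); apply: trace_menage_mx_horner; first by field.
  set r := sqrtC _.
  (* Only r^2 = t^2 - 4 t enters, whatever its sign, and the product is 1; the integrand is thus
     real. *)
  have -> : ((t - 2)%:C + r) / 2 * (((t - 2)%:C - r) / 2) =
      ((t - 2)%:C ^+ 2 - r ^+ 2) / 4 by field.
  rewrite sqrtCK -rmorphXn -rmorphB.
  have -> : (t - 2) ^+ 2 - (t ^+ 2 - 4 * t) = 4 :> R by ring.
  by rewrite rmorph_nat divff// pnatr_eq0.
rewrite fE /Cintegral /= Rintegral_cst// mul0r Rintegral_hornerexpN.
rewrite -[Complex _ 0]/((poly_fact q)%:C).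
rewrite -[LHS](rmorph_nat (real_complex R)) menage_poly_factE//.
by rewrite 2!(rmorphM (real_complex R)) !(rmorph_nat (real_complex R)).
Qed.

End MenageIntegral.

(** * The exponential integral *)

Section ExpIntegral.
Variable R : realType.
Local Notation mu := (@lebesgue_measure R).
Local Open Scope classical_set_scope.

(* [\sum_k x^k / (k k!)], an antiderivative of [(e^x - 1) / x]; the term
   [k = 0] vanishes because [0^-1 = 0]. *)
Definition Ein_coeff (k : nat) : R := (k%:R * k`!%:R)^-1.
Definition Ein (x : R) : R := limn (pseries Ein_coeff x).
Definition dEin (x : R) : R := limn (pseries (pseries_diffs Ein_coeff) x).

Lemma cvg_pseries_le_fact (c : nat -> R) x :
  (forall k, `|c k| <= k`!%:R^-1) -> cvgn (pseries c x).
Proof.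
move=> c_le; apply: normed_cvg.
apply: (series_le_cvg _ _ _ (is_cvg_series_exp_coeff `|x|)) => n /=.
- exact: normr_ge0.
- exact: exp_coeff_ge0.
- by rewrite normrM normrX mulrC ler_wpM2l ?exprn_ge0.
Qed.

Lemma pseries_diffs_Ein k : pseries_diffs Ein_coeff k = (k.+1`!%:R)^-1.
Proof.
by rewrite /pseries_diffs /Ein_coeff invfM mulrA divff ?mul1r ?pnatr_eq0.
Qed.

(** Termwise differentiation: the series and its first two formal derivatives converge at |x| + 1,
    since all their coefficients are at most 1/k!. *)
Lemma is_derive_Ein (x : R) : is_derive x 1 Ein (dEin x).
Proof.
have inv_le (m n : nat) : (0 < n <= m)%N -> (m%:R^-1 : R) <= n%:R^-1.
  by move=> /andP[n0 nm]; rewrite lef_pV2 ?posrE ?ltr0n ?ler_nat// (leq_trans n0).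
apply: (@pseries_snd_diffs _ Ein_coeff (`|x| + 1)).
- apply: cvg_pseries_le_fact => -[|k]; rewrite /Ein_coeff.
    by rewrite mul0r invr0 normr0 invr_ge0.
  rewrite -natrM ger0_norm ?invr_ge0 ?ler0n//.
  by apply: inv_le; rewrite fact_gt0 leq_pmull.
- apply: cvg_pseries_le_fact => k; rewrite pseries_diffs_Ein.
  rewrite ger0_norm ?invr_ge0 ?ler0n//.
  by apply: inv_le; rewrite fact_gt0 factS leq_pmull.
- apply: cvg_pseries_le_fact => k; rewrite {1}/pseries_diffs pseries_diffs_Ein.
  rewrite ger0_norm ?mulr_ge0 ?invr_ge0 ?ler0n//.
  rewrite ler_pdivrMr ?ltr0n ?fact_gt0// ler_pdivlMl ?ltr0n ?fact_gt0//.
  by rewrite -natrM ler_nat !factS; nia.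
- by rewrite [ltRHS]ger0_norm ?addr_ge0// ltrDl.
Qed.

Lemma dEinE x : x * dEin x = expR x - 1.
Proof.
have cvg_d : series (fun k => pseries_diffs Ein_coeff k * x ^+ k) @ \oo --> dEin x.
  apply: cvg_pseries_le_fact => k; rewrite pseries_diffs_Ein.
  rewrite ger0_norm ?invr_ge0 ?ler0n// lef_pV2 ?posrE ?ltr0n ?fact_gt0//.
  by rewrite ler_nat factS leq_pmull.
have cvg_e : [sequence series (exp_coeff x) n.+1]_n @ \oo --> expR x.
  by rewrite cvg_shiftS; exact: is_cvg_series_exp_coeff.
have cvg_xd : x * series (fun k => pseries_diffs Ein_coeff k * x ^+ k) n
    @[n --> \oo] --> x * dEin x by exact: cvgMr.
rewrite -(cvg_lim (@norm_hausdorff _ _) cvg_xd); apply: cvg_lim => //.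
rewrite (_ : (fun n => _) = (fun n => series (exp_coeff x) n.+1 - 1)); last first.
  apply/funext => n; rewrite /= /series /= big_nat_recl//=.
  rewrite {1}/exp_coeff /= expr0 fact0 divr1 addrC addKr.
  rewrite mulr_sumr; apply: eq_bigr => i _.
  by rewrite pseries_diffs_Ein mulrCA -exprS mulrC.
by apply: cvgB; [exact: cvg_e|exact: cvg_cst].
Qed.

(** An antiderivative of e^x / x on both half-lines: the first summand is ln |x|, written so that
    one formula serves both signs. *)
Definition Ei_primitive (x : R) : R := ln (x ^+ 2) / 2 + Ein x.

Lemma is_derive_Ei_primitive (x : R) : x != 0 ->
  is_derive x 1 Ei_primitive (expR x / x).
Proof.
move=> x0; have x2 : 0 < x ^+ 2 by rewrite exprn_even_gt0.
have dln : is_derive x 1 (fun t => ln (t ^+ 2)) ((x ^+ 2)^-1 * (2 * x)).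
  apply: (@is_derive1_comp _ (@ln R) (fun t => t ^+ 2)); first exact: is_derive1_ln.
  apply: is_derive_eq (is_derive1X (is_derive_id x 1) 2) _.
  by rewrite /= mulr1.
have d := is_derive1D (is_derive1Ml dln 2^-1) (is_derive_Ein x).
rewrite (_ : Ei_primitive = fun t => 2^-1 * ln (t ^+ 2) + Ein t); last first.
  by apply/funext => t; rewrite /Ei_primitive mulrC.
apply: is_derive_eq d _.
have -> : expR x = x * dEin x + 1 by rewrite dEinE subrK.
by field.
Qed.
End ExpIntegral.

(** * The principal value through an antiderivative *)

Section EiE.
Variable R : realType.
Local Notation mu := (@lebesgue_measure R).
Local Notation F := (@Ei_primitive R).
Local Open Scope classical_set_scope.

Lemma is_derive_Ei_primitiveN (s : R) : s != 0 ->
  is_derive s 1 (fun s => F (- s)) (expR (- s) / s).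
Proof.
move=> s0; have dN : is_derive s 1 (fun t : R => - t) (-1).
  by apply: is_derive1N; exact: is_derive_id.
have d := is_derive_Ei_primitive (_ : - s != 0); rewrite oppr_eq0 in d.
apply: is_derive_eq (is_derive1_comp (d s0) dN) _.
by field.
Qed.

(** For s >= 1 the function F(-s) increases, while F(-s) + e^(-s) decreases because e^(-s) / s <=
    e^(-s); so F(-s) is bounded by F(-1) + e^(-1). *)
Lemma Ei_primitive_cvgNy : exists c : R, F (- s) @[s --> +oo%R] --> c.
Proof.
(* Freezing the argument below 1 makes the function monotone on the whole line. *)
pose g (s : R) := F (- Num.max 1 s).
suff [c gc] : exists c : R, g s @[s --> +oo%R] --> c.
  exists c; apply: cvg_trans gc; apply: near_eq_cvg; near=> s.
  by rewrite /g max_r//; near: s; apply: nbhs_pinfty_ge; exact: num_real.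
have max1 s : 1 <= Num.max 1 s :> R by rewrite le_max lexx.
exists (sup (range g)); apply: nondecreasing_cvgr.
  move=> s s' ss'; apply: (is_derive_le (f := fun s => F (- s))
    (df := fun s => expR (- s) / s)).
  - by rewrite ge_max !le_max lexx ss' orbT.
  - move=> x /andP[sx _]; apply: is_derive_Ei_primitiveN.
    by rewrite gt_eqF// (lt_le_trans ltr01)// (le_trans _ sx).
  - move=> x /andP[sx _]; rewrite divr_ge0 ?expR_ge0//.
    by rewrite (le_trans ler01)// (le_trans _ sx).
exists (F (- 1) + expR (- 1)) => _ [s _ <-]; rewrite /g.
apply: (@le_trans _ _ (F (- Num.max 1 s) + expR (- Num.max 1 s))).
  by rewrite lerDl expR_ge0.
rewrite -[leLHS]opprK -[leRHS]opprK lerN2.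
apply: (is_derive_le (f := fun s => - (F (- s) + expR (- s)))
  (df := fun s => - (expR (- s) / s - expR (- s)))) => // x /andP[x1 _].
  apply: is_derive1N; apply: is_derive1D (is_derive_expN x).
  by apply: is_derive_Ei_primitiveN; rewrite gt_eqF// (lt_le_trans ltr01).
rewrite opprB subr_ge0 ler_pdivrMr ?(lt_le_trans ltr01)//.
by rewrite ler_peMr ?expR_ge0.
Unshelve. all: by end_near. Qed.

Lemma continuous_expRV (x : R) : x != 0 -> {for x, continuous (fun t : R => expR t / t)}.
Proof.
move=> x0; apply: cvgM; first exact: continuous_expR.
by apply: cvgV => //; exact: cvg_id.
Qed.

Lemma integral_expRV_itv (a b : R) : 0 < a -> a < b ->
  (\int[mu]_(x in `[a, b]) (expR x / x)%:E = (F b - F a)%:E)%E.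
Proof.
move=> a0 ab.
have neq0 x : a <= x -> x != 0 by move=> ax; rewrite gt_eqF// (lt_le_trans a0).
rewrite (@continuous_FTC2 _ _ F)//.
- apply: continuous_in_subspaceT => x; rewrite inE /= in_itv /= => /andP[ax _].
  by apply: continuous_expRV; exact: neq0.
- split.
  + move=> x; rewrite in_itv /= => /andP[/ltW ax _].
    by have [] := is_derive_Ei_primitive (neq0 _ ax).
  + by apply: cvg_at_right_filter; exact/is_derive1_cvg/is_derive_Ei_primitive/neq0.
  + apply: cvg_at_left_filter; apply/is_derive1_cvg/is_derive_Ei_primitive/neq0.
    exact: ltW.
- move=> x; rewrite in_itv /= => /andP[/ltW ax _].
  by rewrite derive1E; have [_] := is_derive_Ei_primitive (neq0 _ ax).
Qed.

(** The sign makes the integrand nonnegative for negative x; the reflection x |-> -x then moves the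
    integral to a half-line ending at +oo, where the fundamental theorem applies. *)
Lemma integral_expRV_Ny (c z : R) : F (- s) @[s --> +oo%R] --> c -> z < 0 ->
  (\int[mu]_(x in `]-oo, z]) (- (expR x / x))%:E = (c - F z)%:E)%E.
Proof.
move=> Fc z0; have z0' : 0 < - z by rewrite oppr_gt0.
have neq0 x : - z <= x -> x != 0.
  by move=> zx; rewrite gt_eqF// (lt_le_trans _ zx).
rewrite -[z in LHS]opprK.
rewrite (@ge0_integration_by_substitutionNy _ (fun x => - (expR x / x))).
- have eqf : (fun x : R => - (expR x / x)) \o -%R = (fun x => expR (- x) / x).
    by apply/funext => x /=; rewrite invrN mulrN opprK.
  rewrite eqf (@ge0_continuous_FTC2y _ _ (fun s => F (- s)) _ c)//.
  + by rewrite opprK.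
  + by move=> x zx; rewrite divr_ge0 ?expR_ge0// (le_trans (ltW z0')).
  + apply: continuous_in_subspaceT => x; rewrite inE /= in_itv /= andbT => zx.
    apply: cvgM; first exact: is_derive1_cvg (is_derive_expN x).
    by apply: cvgV; [exact: neq0|exact: cvg_id].
  + by move=> x /ltW zx; have [] := is_derive_Ei_primitiveN (neq0 _ zx).
  + by apply: cvg_at_right_filter; exact/is_derive1_cvg/is_derive_Ei_primitiveN/neq0.
  + move=> x; rewrite in_itv /= andbT => /ltW zx.
    by rewrite derive1E; have [_] := is_derive_Ei_primitiveN (neq0 _ zx).
- apply: continuous_in_subspaceT => x; rewrite inE /= in_itv /= opprK => xz.
  by apply: cvgN; apply: continuous_expRV; rewrite lt_eqF// (le_lt_trans xz).
- move=> x; rewrite in_itv /= opprK => xz.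
  by rewrite -mulrN -invrN divr_ge0 ?expR_ge0// oppr_ge0 ltW// (lt_trans xz).
Qed.

Lemma integrable_expRV_itv (a b : R) : 0 < a ->
  mu.-integrable `[a, b] (EFin \o (fun x : R => expR x / x)).
Proof.
move=> a0; apply: continuous_compact_integrable; first exact: segment_compact.
apply: continuous_in_subspaceT => x; rewrite inE /= in_itv /= => /andP[ax _].
by apply: continuous_expRV; rewrite gt_eqF// (lt_le_trans a0).
Qed.

Lemma integrable_expRV_Ny (z : R) : z < 0 ->
  mu.-integrable `]-oo, z] (EFin \o (fun x : R => expR x / x)).
Proof.
move=> z0; have [c Fc] := Ei_primitive_cvgNy.
have xlt0 (x : R) : x <= z -> x < 0 by move=> xz; rewrite (le_lt_trans xz).
apply/integrableP; split.
  apply/measurable_EFinP; apply: subspace_continuous_measurable_fun => //.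
  apply: continuous_in_subspaceT => x; rewrite inE /= in_itv /= => /xlt0 x0.
  by apply: continuous_expRV; rewrite lt_eqF.
apply: (@le_lt_trans _ _ (c - F z)%:E); last exact: ltry.
rewrite -integral_expRV_Ny// le_eqVlt; apply/orP; left; apply/eqP.
apply: eq_integral => x; rewrite inE /= in_itv /= => /xlt0 x0.
by rewrite ler0_norm// mulr_ge0_le0 ?expR_ge0// invr_le0 ltW.
Qed.

Lemma Rintegral_expRV_Ny (c z : R) : F (- s) @[s --> +oo%R] --> c -> z < 0 ->
  \int[mu]_(x in `]-oo, z]) (expR x / x) = F z - c.
Proof.
move=> Fc z0; apply: oppr_inj.
rewrite opprB -mulN1r -RintegralZl//; last exact: integrable_expRV_Ny.
under eq_Rintegral do rewrite mulN1r.
by rewrite /Rintegral (integral_expRV_Ny Fc z0).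
Qed.

Lemma Ei_domain_lt0 (e z : R) : e <= - z ->
  [set t | t <= z /\ e <= `|t|] = `]-oo, z].
Proof.
move=> ez; apply/seteqP; split=> t /=; rewrite in_itv /=; first by case.
move=> tz; split=> //; rewrite (le_trans ez)// (@le_trans _ _ (- t)) ?lerN2//.
by rewrite -normrN ler_norm.
Qed.

Lemma Ei_domain_gt0 (e z : R) : 0 < e -> e < z ->
  [set t | t <= z /\ e <= `|t|] = `]-oo, - e] `|` `[e, z].
Proof.
move=> e0 ez; apply/seteqP; split=> t /=; rewrite !in_itv /=.
  by case=> tz; rewrite ler_normr lerNr => /orP[et|te]; [right; rewrite et tz|left].
case=> [te|/andP[et tz]].
  by split; [lra|rewrite -normrN (le_trans _ (ler_norm _))// lerNr].
by split=> //; rewrite (le_trans et)// ler_norm.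
Qed.

Lemma integrable_setU (d : measure_display) (T : measurableType d)
    (nu : {measure set T -> \bar R}) (A B : set T) (f : T -> \bar R) :
  measurable A -> measurable B -> [disjoint A & B] ->
  nu.-integrable A f -> nu.-integrable B f -> nu.-integrable (A `|` B) f.
Proof.
move=> mA mB AB /integrableP[fA iA] /integrableP[fB iB].
have fAB : measurable_fun (A `|` B) f by apply/measurable_funU.
apply/integrableP; split=> //; rewrite ge0_integral_setU//.
  exact: lte_add_pinfty.
exact: measurableT_comp.
Qed.

(** For z < 0 the excision around 0 is eventually vacuous. For z > 0 the two pieces contribute F(-e)
    - c and F(z) - F(e); the logarithms cancel by evenness, leaving Ein(-e) - Ein(e), which tends to
    0. *)
Lemma EiE : exists c : R, F (- s) @[s --> +oo%R] --> c /\
  forall z : R, z != 0 -> Ei z = F z - c.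
Proof.
have [c Fc] := Ei_primitive_cvgNy; exists c; split=> // z z0.
apply: cvg_lim => //; have [zlt0|zgt0] : z < 0 \/ 0 < z by case: ltgtP z0; [left|right|].
  apply: (cvg_trans _ (@cvg_cst _ (F z - c) _ (0^'+) _)); apply: near_eq_cvg; near=> e.
  rewrite Ei_domain_lt0 ?(Rintegral_expRV_Ny Fc)//.
  by near: e; apply: nbhs_right_ltW; rewrite oppr_gt0.
apply: (@cvg_trans _ ((fun e => F z - c + (Ein (- e) - Ein e)) @ 0^'+)).
  apply: near_eq_cvg; near=> e.
  have e0 : 0 < e by [].
  have ez : e < z by near: e; exact: nbhs_right_lt.
  have eNe : - e < 0 by rewrite oppr_lt0.
  have disj : [disjoint `]-oo, - e] & `[e, z]].
    apply/disj_setPS => x /=; rewrite !in_itv /= => -[xe /andP[ex _]].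
    by move: (le_trans ex xe); rewrite leNgt (lt_trans eNe e0).
  rewrite Ei_domain_gt0// Rintegral_setU//=; last first.
    apply: integrable_setU => //; first exact: integrable_expRV_Ny.
    exact: integrable_expRV_itv.
  rewrite (Rintegral_expRV_Ny Fc)// [X in _ = _ + X]/Rintegral integral_expRV_itv//=.
  by rewrite /Ei_primitive sqrrN; ring.
suff: (F z - c + (Ein (- e) - Ein e)) @[e --> 0^'+] --> F z - c + (Ein 0 - Ein 0).
  by rewrite subrr addr0.
apply: cvg_at_right_filter; apply: cvgD; first exact: cvg_cst.
apply: cvgB; last exact: is_derive1_cvg (is_derive_Ein 0).
have dN : is_derive (0 : R) 1 (fun e => Ein (- e)) (dEin (- 0) * -1).
  have d0 : is_derive (0 : R) 1 (fun t : R => - t) (-1).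
    by apply: is_derive1N; exact: is_derive_id.
  exact: is_derive1_comp (is_derive_Ein _) d0.
by have := is_derive1_cvg dN; rewrite oppr0.
Unshelve. all: by end_near. Qed.

End EiE.

(** * The asymptotic expansion of Ei at infinity *)

Section EiAsymptotics.
Variable R : realType.
Local Open Scope classical_set_scope.

Definition ei_term k (z : R) : R := k`!%:R * (expR z / z ^+ k.+1).

Lemma is_derive_ei_term k (z : R) : z != 0 ->
  is_derive z 1 (ei_term k) (ei_term k z - ei_term k.+1 z).
Proof.
move=> z0; have zk : z ^+ k.+1 != 0 by rewrite expf_neq0.
have dX := is_derive1X (is_derive_id z 1) k.+1.
have dV := is_derive1V dX zk.
apply: is_derive_eq (is_derive1Ml (is_derive1M (is_derive_expR z) dV) k`!%:R) _.
rewrite /ei_term factS natrM /= !exprS; set u := z ^+ k.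
have u0 : u != 0 by rewrite expf_neq0.
by field; rewrite z0 u0.
Qed.

(** The derivatives [ei_term k z - ei_term k.+1 z] telescope. *)
Lemma is_derive_ei_sum N (z : R) : z != 0 ->
  is_derive z 1 (fun z => \sum_(k < N) ei_term k z) (expR z / z - ei_term N z).
Proof.
move=> z0; elim: N => [|N IH].
  rewrite (_ : (fun _ => _) = cst 0); last by apply/funext => t; rewrite big_ord0.
  by apply: is_derive_eq; rewrite /ei_term fact0 mul1r expr1 subrr.
rewrite (_ : (fun _ => _) = (fun z => \sum_(k < N) ei_term k z + ei_term N z)).
  by apply: is_derive_eq (is_derive1D IH (is_derive_ei_term N z0)) _; ring.
by apply/funext => t; rewrite big_ord_recr.
Qed.

Section Remainder.
Variable c : R.
Hypothesis Fc : Ei_primitive (- s) @[s --> +oo%R] --> c.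

(** By [EiE], the error of the first [N] terms of the expansion of Ei. *)
Definition ei_rem N (z : R) := Ei_primitive z - c - \sum_(k < N) ei_term k z.

Lemma is_derive_ei_rem N (z : R) : z != 0 ->
  is_derive z 1 (ei_rem N) (ei_term N z).
Proof.
move=> z0.
have dF := is_derive1B (is_derive_Ei_primitive z0) (is_derive_cst c z 1).
by apply: is_derive_eq (is_derive1B dF (is_derive_ei_sum N z0)) _; ring.
Qed.

Lemma ei_remS N z : ei_rem N.+1 z = ei_rem N z - ei_term N z.
Proof. by rewrite /ei_rem big_ord_recr /= opprD addrA. Qed.

Lemma cvg_ei_termN k : ei_term k (- s) @[s --> +oo%R] --> (0 : R).
Proof.
have inv0 : - s^-1 @[s --> +oo%R] --> (0 : R).
  rewrite -[X in _ --> X]oppr0; apply: cvgN; apply/gtr0_cvgV0; last exact: cvg_id.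
  by apply: nbhs_pinfty_gt; exact: num_real.
suff h : expR (- s) * (- s^-1) ^+ k.+1 @[s --> +oo%R] --> (0 : R).
  rewrite (_ : (fun s => _) = fun s => k`!%:R * (expR (- s) * (- s^-1) ^+ k.+1)).
    by rewrite -[X in _ --> X](mulr0 k`!%:R); apply: cvgMr.
  by apply/funext => s; rewrite /ei_term -exprVn invrN.
elim: k.+1 => [|m IH].
  rewrite (_ : (fun s => _) = fun s => s ^+ 0 * expR (- s)).
    exact: cvg_expMexpN.
  by apply/funext => s; rewrite !expr0 mulrC.
rewrite (_ : (fun s => _) = fun s => - s^-1 * (expR (- s) * (- s^-1) ^+ m)).
  by rewrite -[X in _ --> X](mulr0 (0 : R)); exact: cvgM.
by apply/funext => s; rewrite exprS mulrCA.
Qed.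

Lemma cvg_ei_sumN N : \sum_(k < N) ei_term k (- s) @[s --> +oo%R] --> (0 : R).
Proof.
elim: N => [|N IH].
  rewrite (_ : (fun s => _) = cst 0); first exact: cvg_cst.
  by apply/funext => s; rewrite big_ord0.
rewrite (_ : (fun s => _) = fun s => \sum_(k < N) ei_term k (- s) + ei_term N (- s)).
  by rewrite -[X in _ --> X]addr0; apply: cvgD => //; exact: cvg_ei_termN.
by apply/funext => s; rewrite big_ord_recr.
Qed.

(** The remainder vanishes at -oo, and its derivative [ei_term N] has the sign of (-1)^(N+1) on the
    negative half-line. *)
Lemma ei_rem_sign N z : z < 0 -> (-1) ^+ N * ei_rem N z <= 0.
Proof.
move=> z0.
have lim0 : (-1) ^+ N * ei_rem N (- s) @[s --> +oo%R] --> (0 : R).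
  rewrite -[X in _ --> X](mulr0 ((-1) ^+ N)); apply: cvgMr.
  rewrite -[X in _ --> X]subr0 -[X in _ --> X - _](subrr c).
  apply: cvgB; first by apply: cvgB => //; exact: cvg_cst.
  exact: cvg_ei_sumN.
apply: (cvgr_to_ge lim0); near=> s.
have zs : - z <= s by near: s; apply: nbhs_pinfty_ge; exact: num_real.
have pos x : - z <= x -> 0 < x by apply: lt_le_trans; rewrite oppr_gt0.
rewrite -[z in leLHS]opprK.
apply: (is_derive_le (f := fun s => (-1) ^+ N * ei_rem N (- s))
  (df := fun s => (-1) ^+ N * (ei_term N (- s) * -1))) => [|x|x]; first exact: zs.
  move=> /andP[/pos x0 _].
  apply: is_derive1Ml; apply: (@is_derive1_comp _ _ (fun t => - t)).
    by apply: is_derive_ei_rem; rewrite oppr_eq0 gt_eqF.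
  by apply: is_derive1N; exact: is_derive_id.
move=> /andP[/pos x0 _].
rewrite /ei_term (exprNn x) invfM invr_sign [(-1) ^+ N.+1]exprS.
set e := (-1) ^+ N; have ee : e * e = 1 by rewrite -expr2 sqrr_sign.
have -> : e * (N`!%:R * (expR (- x) * (-1 * e * (x ^+ N.+1)^-1)) * -1) =
  (e * e) * (N`!%:R * (expR (- x) / x ^+ N.+1)) by ring.
by rewrite ee mul1r !mulr_ge0 ?expR_ge0 ?invr_ge0 ?exprn_ge0 ?ltW.
Unshelve. all: by end_near. Qed.

(** Consecutive remainders have opposite signs and differ by [ei_term N z], as in an alternating
    series. *)
Lemma ei_rem_lt0 N z : z < 0 -> `|ei_rem N z| <= `|ei_term N z|.
Proof.
move=> z0; have := ei_rem_sign N z0; have := ei_rem_sign N.+1 z0.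
rewrite ei_remS exprS mulN1r mulNr oppr_le0 mulrBr subr_ge0 => le1 le0.
rewrite -[leLHS](normrMsign N) -[leRHS](normrMsign N) ler0_norm//.
by rewrite -[leRHS]normrN (le_trans _ (ler_norm _))// lerN2.
Qed.

(** From 2 (N + 1) on, [ei_term N.+1] is at most half of [ei_term N], so the derivative of twice
    [ei_term N] dominates that of the remainder. The remainder also increases, and [K] absorbs its
    value at the left end. *)
Lemma ei_rem_gt0 N : exists2 K, 0 <= K & forall z, (2 * N.+1)%:R <= z ->
  `|ei_rem N z| <= 2 * ei_term N z + K.
Proof.
pose a : R := (2 * N.+1)%:R; have a0 : 0 < a by rewrite ltr0n.
have pos x : a <= x -> 0 < x by apply: lt_le_trans.
have term_ge0 k x : 0 < x -> 0 <= ei_term k x.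
  by move=> x0; rewrite !mulr_ge0 ?expR_ge0 ?invr_ge0 ?exprn_ge0 ?ltW.
exists (`|ei_rem N a|); first exact: normr_ge0.
move=> z az.
have low : ei_rem N a <= ei_rem N z.
  apply: (is_derive_le (df := ei_term N)) => // x /andP[/pos x0 _].
    by apply: is_derive_ei_rem; rewrite gt_eqF.
  exact: term_ge0.
have up : 2 * ei_term N a - ei_rem N a <= 2 * ei_term N z - ei_rem N z.
  apply: (is_derive_le (f := fun x => 2 * ei_term N x - ei_rem N x)
    (df := fun x => 2 * (ei_term N x - ei_term N.+1 x) - ei_term N x)) => [|x|x]; first exact: az.
    move=> /andP[/pos x0 _].
    apply: is_derive1B; last by apply: is_derive_ei_rem; rewrite gt_eqF.
    by apply: is_derive1Ml; apply: is_derive_ei_term; rewrite gt_eqF.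
  move=> /andP[ax _]; have x0 := pos _ ax.
  have -> : ei_term N.+1 x = N.+1%:R / x * ei_term N x.
    rewrite /ei_term factS natrM [x ^+ N.+2]exprS.
    by field; rewrite expf_neq0 gt_eqF.
  have -> : 2 * (ei_term N x - N.+1%:R / x * ei_term N x) - ei_term N x =
     (1 - (2 * N.+1)%:R / x) * ei_term N x by rewrite natrM; ring.
  by rewrite mulr_ge0 ?term_ge0// subr_ge0 ler_pdivrMr// mul1r.
have ta := term_ge0 N _ a0; have tz := term_ge0 N _ (pos _ az).
rewrite ler_norml; have := ler_norm (ei_rem N a); have := ler_norm (- ei_rem N a).
rewrite normrN => h1 h2; apply/andP; split; lra.
Qed.
End Remainder.

Lemma Ei_asymptotic N : exists C A : R, 0 < A /\ forall z : R, A <= `|z| ->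
  `|z * expR (- z) * Ei z - \sum_(k < N) k`!%:R * z^-1 ^+ k| <= C * `|z^-1| ^+ N.
Proof.
have [c [Fc EE]] := EiE R; have [K K0 HK] := ei_rem_gt0 c N.
(* The first summand comes from twice [ei_term N]; the second from z e^(-z) <= (N+1)! / z^N, for z >
   0. *)
exists (2 * N`!%:R + K * N.+1`!%:R), (2 * N.+1)%:R; split; first by rewrite ltr0n.
move=> z Az; have z0 : z != 0.
  by rewrite -normr_gt0 (lt_le_trans _ Az)// ltr0n.
have expK : expR (- z) * expR z = 1 by rewrite mulrC expRxMexpNx_1.
have termE k : z * expR (- z) * ei_term k z = k`!%:R * z^-1 ^+ k.
  have -> : z * expR (- z) * ei_term k z = (expR (- z) * expR z) * (k`!%:R * (z / z ^+ k.+1)).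
    by rewrite /ei_term; ring.
  by rewrite expK mul1r exprS invfM mulVKf// exprVn.
have -> : z * expR (- z) * Ei z - \sum_(k < N) k`!%:R * z^-1 ^+ k =
    z * expR (- z) * ei_rem c N z.
  rewrite /ei_rem -EE// mulrBr; congr (_ - _); rewrite mulr_sumr.
  by apply: eq_bigr => k _; rewrite termE.
rewrite normrM.
have [zlt0|zgt0] : z < 0 \/ 0 < z by case: ltgtP z0; [left|right|].
  apply: (@le_trans _ _ (`|z * expR (- z)| * `|ei_term N z|)).
    by rewrite ler_wpM2l// ei_rem_lt0.
  rewrite -normrM termE normrM normrX ler_wpM2r ?exprn_ge0// normr_nat.
  by rewrite ler_wpDr ?mulr_ge0// ler_peMl// ler1n.
rewrite gtr0_norm// in Az.
apply: (@le_trans _ _ (z * expR (- z) * (2 * ei_term N z + K))).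
  rewrite ger0_norm ?mulr_ge0 ?expR_ge0 ?(ltW zgt0)//.
  by rewrite ler_wpM2l ?mulr_ge0 ?expR_ge0 ?(ltW zgt0)// HK.
rewrite mulrDr mulrCA termE [leRHS]mulrDl ger0_norm ?invr_ge0 ?(ltW zgt0)//.
rewrite [2 * (_ * _)]mulrA lerD2l mulrC -mulrA ler_wpM2l// expRN exprVn.
rewrite ler_pdivlMr ?exprn_gt0// mulrAC -exprS ler_pdivrMr ?expR_gt0//.
rewrite -ler_pdivrMl ?ltr0n ?fact_gt0// mulrC.
by rewrite (le_trans _ (expR_ge1Dxn N (ltW zgt0)))// lerDr.
Qed.
End EiAsymptotics.

(** * Expansions at zero *)

Section Expansions.
Variable R : realType.
Implicit Types (f g : R -> R) (s t : fps R).
Local Open Scope classical_set_scope.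

Definition fps_trunc N s : {poly R} := \poly_(i < N) fps_coef s i.

(** Expansion with error O(x^N), a form stable under sums and products with explicit constants;
    order N + 1 yields the o(x^N) of [asymptotic_to]. *)
Definition expansion N f s := exists C : R, \forall x \near 0^',
  `|f x - (fps_trunc N s).[x]| <= C * `|x| ^+ N.

Lemma expansion_near N f g s :
  (\forall x \near 0^', f x = g x) -> expansion N f s -> expansion N g s.
Proof.
move=> fg [C fC]; exists C; near=> x.
have <- : f x = g x by near: x.
by near: x.
Unshelve. all: by end_near. Qed.

Lemma expansion_eql N f s t :
  (forall i, (i < N)%N -> fps_coef s i = fps_coef t i) ->
  expansion N f s -> expansion N f t.
Proof.
move=> st; rewrite /expansion; suff -> : fps_trunc N t = fps_trunc N s by [].
by apply/polyP => i; rewrite !coef_poly; case: ltnP => // /st.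
Qed.

Lemma horner_near0_le (p : {poly R}) :
  exists2 C : R, 0 <= C & \forall x \near 0^', `|p.[x]| <= C.
Proof.
exists (\sum_(i < size p) `|p`_i|); first by apply: sumr_ge0.
near=> x.
have x1 : `|x| <= 1 by near: x; apply: dnbhs0_le.
rewrite horner_coef (le_trans (ler_norm_sum _ _ _))// ler_sum// => i _.
by rewrite normrM normrX ler_piMr// exprn_ile1.
Unshelve. all: by end_near. Qed.

Lemma expansion_horner N (p : {poly R}) s :
  (forall i, (i < N)%N -> p`_i = fps_coef s i) -> expansion N (horner p) s.
Proof.
move=> ps; rewrite /expansion; have -> : fps_trunc N s = take_poly N p.
  apply/polyP => i; rewrite coef_poly coef_take_poly.
  by case: ltnP => // /ps.
have [C C0 HC] := horner_near0_le (drop_poly N p).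
exists C; near=> x.
rewrite -{1}(poly_take_drop N p) hornerD [_ + _.[x]]addrC addrK.
rewrite hornerM hornerXn normrM normrX ler_wpM2r ?exprn_ge0//.
by near: x.
Unshelve. all: by end_near. Qed.

Lemma expansionD N f g s t :
  expansion N f s -> expansion N g t -> expansion N (fun x => f x + g x) (s + t).
Proof.
move=> [C fC] [D gD]; exists (C + D); near=> x.
have -> : fps_trunc N (s + t) = fps_trunc N s + fps_trunc N t.
  by apply/polyP => i; rewrite coefD !coef_poly; case: ifP => //; rewrite addr0.
rewrite hornerD opprD addrACA mulrDl (le_trans (ler_normD _ _))//.
by apply: lerD; near: x.
Unshelve. all: by end_near. Qed.

Lemma expansionM N f g s t :
  expansion N f s -> expansion N g t -> expansion N (fun x => f x * g x) (s * t).
Proof.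
move=> [C fC] [D gD]; set p := fps_trunc N s in fC *; set q := fps_trunc N t in gD *.
have [E pqE] : expansion N (horner (p * q)) (s * t).
  apply: expansion_horner => i iN; rewrite coefM fps_coefM; apply: eq_bigr => j _.
  have jN : (j < N)%N by rewrite (leq_ltn_trans _ iN)// -ltnS.
  by rewrite !coef_poly jN (leq_ltn_trans (leq_subr _ _) iN).
have [P P0 pP] := horner_near0_le p; have [Q Q0 qQ] := horner_near0_le q.
(* One constant for each piece: the terms of [p * q] of degree at least N, the two products of a
   polynomial with an error, and the product of the errors. *)
exists (E + P * `|D| + Q * `|C| + `|C| * `|D|); near=> x.
have x1 : `|x| <= 1 by near: x; apply: dnbhs0_le.
have xN1 : `|x| ^+ N <= 1 by rewrite exprn_ile1.
have xN0 : 0 <= `|x| ^+ N by rewrite exprn_ge0.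
have fpx : `|f x - p.[x]| <= C * `|x| ^+ N by near: x.
have gqx : `|g x - q.[x]| <= D * `|x| ^+ N by near: x.
pose u := f x - p.[x]; pose v := g x - q.[x].
have uC : `|u| <= `|C| * `|x| ^+ N.
  by rewrite (le_trans fpx)// ler_wpM2r ?ler_norm.
have vD : `|v| <= `|D| * `|x| ^+ N.
  by rewrite (le_trans gqx)// ler_wpM2r ?ler_norm.
have -> : f x * g x - (fps_trunc N (s * t)).[x] =
    ((p * q).[x] - (fps_trunc N (s * t)).[x]) + p.[x] * v + q.[x] * u + u * v.
  by rewrite hornerM /u /v; ring.
rewrite (le_trans (ler_normD _ _))// [leRHS]mulrDl; apply: lerD; last first.
  rewrite normrM (le_trans (ler_pM _ _ uC vD))// mulrACA -!mulrA ler_wpM2l//.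
  by rewrite ler_wpM2l// ler_piMl.
rewrite (le_trans (ler_normD _ _))// [leRHS]mulrDl; apply: lerD; last first.
  by rewrite normrM -mulrA ler_pM//; near: x.
rewrite (le_trans (ler_normD _ _))// [leRHS]mulrDl; apply: lerD; last first.
  by rewrite normrM -mulrA ler_pM//; near: x.
by near: x.
Unshelve. all: by end_near. Qed.

Lemma expansionX N : expansion N id (fpsX R).
Proof.
have := @expansion_horner N 'X (fpsX R).
rewrite (_ : horner 'X = id); last by apply/funext => x; rewrite hornerX.
by apply=> i _; rewrite coefX.
Qed.

Lemma expansion_nat N k : expansion N (fun=> k%:R) (k%:R : fps R).
Proof.
have := @expansion_horner N k%:R%:P (k%:R).
rewrite (_ : horner _ = fun=> k%:R); last by apply/funext => x; rewrite hornerC.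
apply=> i _; rewrite coefC fps_coefMn fps_coef1.
by case: i => //=; rewrite mul0rn.
Qed.

Lemma expansionN N f s : expansion N f s -> expansion N (fun x => - f x) (- s).
Proof.
move=> [C fC]; exists C; near=> x.
have -> : fps_trunc N (- s) = - fps_trunc N s.
  by apply/polyP => i; rewrite coefN !coef_poly; case: ifP => //; rewrite oppr0.
by rewrite hornerN -opprD normrN; near: x.
Unshelve. all: by end_near. Qed.

Lemma expansion_exp N f s k : expansion N f s -> expansion N (fun x => f x ^+ k) (s ^+ k).
Proof.
move=> fs; elim: k => [|k IH]; first exact: (@expansion_nat N 1).
rewrite [s ^+ _]exprS; apply: expansion_near (expansionM fs IH).
by near=> x; rewrite exprS.
Unshelve. all: by end_near. Qed.

Lemma expansion_sum N n (F : nat -> R -> R) (S : nat -> fps R) :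
  (forall k, expansion N (F k) (S k)) ->
  expansion N (fun x => \sum_(k < n) F k x) (\sum_(k < n) S k).
Proof.
move=> FS; elim: n => [|n IH].
  rewrite big_ord0; apply: expansion_near (expansion_nat N 0).
  by near=> x; rewrite big_ord0.
rewrite big_ord_recr; apply: expansion_near (expansionD IH (FS n)).
by near=> x; rewrite big_ord_recr.
Unshelve. all: by end_near. Qed.

Lemma fps_coef_onePXV n : fps_coef (1 + fpsX R)^-1 n = (-1) ^+ n.
Proof.
suff -> : (1 + fpsX R)^-1 = Fps (fun n => (-1) ^+ n) by [].
apply: (mulrI (fps_onePX_unit R)); rewrite mulrV ?fps_onePX_unit//.
rewrite mulrDl mul1r; apply: fpsP => -[|k]; rewrite fps_coefD fps_coef1.
  by rewrite fps_coefXM0 addr0.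
by rewrite fps_coefXMS /= exprS mulN1r addNr.
Qed.

Lemma expansion_onePXV N : expansion N (fun x => (1 + x)^-1) (1 + fpsX R)^-1.
Proof.
(* The remainder of the geometric sum is (-x)^N / (1 + x), and 1 + x >= 1/2 near 0. *)
exists 2; near=> x.
have x2 : `|x| <= 2^-1 by near: x; apply: dnbhs0_le; rewrite invr_gt0.
have [xl xu] : - 2^-1 <= x /\ x <= 2^-1 by move: x2; rewrite ler_norml => /andP.
have x10 : 0 < 1 + x by lra.
have -> : (fps_trunc N (1 + fpsX R)^-1).[x] = \sum_(i < N) (- x) ^+ i.
  rewrite horner_poly; apply: eq_bigr => i _.
  by rewrite fps_coef_onePXV [in RHS]exprNn.
have := subrX1 (- x) N; rewrite -opprB -[X in _ = X * _]opprB opprK mulNr => /oppr_inj geo.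
have -> : (1 + x)^-1 - \sum_(i < N) (- x) ^+ i = (- x) ^+ N / (1 + x).
  apply: (mulIf (lt0r_neq0 x10)); rewrite mulrBl mulVf ?lt0r_neq0// divfK ?lt0r_neq0//.
  by rewrite mulrC -geo; ring.
have inv2 : (1 + x)^-1 <= 2.
  by rewrite -[leRHS]invrK lef_pV2 ?posrE ?invr_gt0//; lra.
rewrite normrM normrX normrN mulrC ler_wpM2r ?exprn_ge0//.
by rewrite ger0_norm// invr_ge0 ltW.
Unshelve. all: by end_near. Qed.

Lemma asymptotic_of_expansion f s : (forall N, expansion N f s) -> asymptotic_to f s.
Proof.
move=> fs N; apply/eqoP => e e0; have [C fC] := fs N.+1.
near=> x.
have xe : `|x| <= e / (`|C| + 1).
  by near: x; apply: dnbhs0_le; rewrite divr_gt0// ltr_wpDl.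
have -> : \sum_(n < N.+1) fps_coef s n * x ^+ n = (fps_trunc N.+1 s).[x].
  by rewrite horner_poly.
apply: (@le_trans _ _ (C * `|x| ^+ N.+1)); first by near: x.
rewrite exprS mulrA normrX ler_wpM2r ?exprn_ge0//.
have xC : `|x| * (`|C| + 1) <= e by rewrite -ler_pdivlMr// ltr_wpDl.
rewrite (le_trans _ xC)// mulrC ler_wpM2l// (le_trans (ler_norm _))// lerDl.
Unshelve. all: by end_near. Qed.

End Expansions.

(** * The menage series *)

Section Conclusion.
Variable R : realType.
Local Open Scope classical_set_scope.

(** Substitute z = 1/y, with y = x / (1 + x)^2, into the expansion of Ei at infinity, whose partial
    sums in y expand in powers of x. *)
Lemma expansion_Ei N :
  expansion N (fun x : R => let z := (x + 1) ^+ 2 / x in z * expR (- z) * Ei z)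
    (fps_fact_sum R).
Proof.
have [C [A [A0 HE]]] := Ei_asymptotic R N.
pose y (x : R) := x * (1 + x)^-1 ^+ 2.
have [D HD] : expansion N (fun x => \sum_(k < N) k`!%:R * y x ^+ k) (fps_fact_sum R).
  pose Y := fpsX R * (1 + fpsX R)^-1 ^+ 2.
  apply: (@expansion_eql _ _ _ (\sum_(k < N) k`!%:R * Y ^+ k)).
    case: N {HE} => // n i iN; rewrite (@fps_fact_sum_coef _ n i iN).
    by rewrite /Y exprVn.
  apply: (@expansion_sum R N N (fun k x => k`!%:R * y x ^+ k)
    (fun k => k`!%:R * Y ^+ k)) => k; apply: expansionM; first exact: expansion_nat.
  apply: expansion_exp; apply: expansionM; first exact: expansionX.
  by apply: expansion_exp; exact: expansion_onePXV.
(* The 4 comes from |y| <= 4 |x|, valid for |x| <= 1/2; it also makes |z| large enough. *)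
exists (`|C| * 4 ^+ N + D); near=> x.
have x0 : x != 0 by near: x; exact: nbhs_dnbhs_neq.
have x2 : `|x| <= 2^-1 by near: x; apply: dnbhs0_le; rewrite invr_gt0.
have xA : `|x| <= (4 * A)^-1 by near: x; apply: dnbhs0_le; rewrite invr_gt0 mulr_gt0.
have [xl xu] : - 2^-1 <= x /\ x <= 2^-1 by move: x2; rewrite ler_norml => /andP.
have xD : `|\sum_(k < N) k`!%:R * y x ^+ k - (fps_trunc N (fps_fact_sum R)).[x]|
  <= D * `|x| ^+ N by near: x.
move: HE => /(_ ((x + 1) ^+ 2 / x)) /=; set z := (x + 1) ^+ 2 / x.
have zV : z^-1 = y x by rewrite /z /y invf_div [x + 1]addrC exprVn.
have y4 : `|y x| <= 4 * `|x|.
  rewrite /y normrM mulrC ler_wpM2r// normrX gtr0_norm ?invr_gt0; last lra.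
  rewrite exprVn -[leRHS]invrK lef_pV2 ?posrE ?invr_gt0 ?exprn_gt0//; last lra.
  by nra.
have y0 : 0 < `|y x|.
  by rewrite normr_gt0 /y mulf_neq0// expf_neq0// invr_eq0 gt_eqF//; lra.
have zA : A <= `|z|.
  rewrite -[z]invrK zV normfV -[leLHS]invrK lef_pV2 ?posrE ?invr_gt0//.
  rewrite (le_trans y4)// -ler_pdivlMl// (le_trans xA)//.
  by rewrite invfM mulrC.
move=> /(_ zA); rewrite zV => HE.
rewrite mulrDl -(subrKA (\sum_(k < N) k`!%:R * y x ^+ k)) (le_trans (ler_normD _ _))//.
apply: lerD => //; rewrite (le_trans HE)// -mulrA -exprMn.
apply: (@le_trans _ _ (`|C| * `|y x| ^+ N)).
  by rewrite ler_wpM2r ?exprn_ge0 ?ler_norm.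
by rewrite ler_wpM2l// lerXn2r ?nnegrE ?mulr_ge0.
Unshelve. all: by end_near. Qed.

Lemma laplace_menage :
  laplace ((fpsX {poly R} ^+ 2 - 1) /
    (fpsX {poly R} * fpsC 'X - (fpsX {poly R} + 1) ^+ 2)) =
  fps_laplace (menage_series R).
Proof. by rewrite laplaceE menage_seriesE. Qed.

Lemma menage0 : menage 0 = 1%N.
Proof.
transitivity #|{: {ffun 'I_0.*2 -> 'I_0 * bool}}|; last first.
  by rewrite card_ffun card_ord expn0.
apply: eq_card => s; rewrite [RHS]inE; apply/mem_set/and3P; split.
- by apply/injectiveP => -[].
- by apply/fintype.forallP => -[].
- by apply/fintype.forallP => -[].
Qed.

Lemma menage1 : menage 1 = 0%N.
Proof.
rewrite menage_card// (_ : #|_| = 0%N) ?muln0//.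
apply: eq_card0 => s; rewrite inE; apply/negbTE/negP => /fintype.forallP /(_ ord0).
by rewrite (ord1 (s _)) eqxx.
Qed.

(** The trace formula holds from n = 2 on. In degree 0 the correction gives 2 - 1 = 1, and in degree
    1 the trace 'X - 2 has value -1, so that +2x is what restores 0. *)
Lemma menage_egfE :
  menage_egf R = -1 + 2 * fpsX R + 2 * fps_laplace (menage_series R).
Proof.
apply: fpsP => n; rewrite !mulr_natl 2!fps_coefD fps_coefN 2!fps_coefMn fps_coef1.
have f1 : poly_fact (1 : {poly R}) = 1 by rewrite -(expr0 'X) poly_factXn.
have f2 : poly_fact (2 : {poly R}) = 2 by rewrite raddfMn /= f1.
have fX : poly_fact ('X : {poly R}) = 1 by rewrite -(expr1 'X) poly_factXn.
case: n => [|[|n]] /=.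
- by rewrite menage0 f1 fact0; field.
- by rewrite menage1 trace_menage_mx1 raddfB /= fX f2; field.
rewrite (menage_poly_factE R)// mulrAC mulfK ?pnatr_eq0 -?lt0n ?fact_gt0//.
by rewrite mulr0n oppr0 mul0rn !add0r mulr_natl.
Qed.

Lemma asymptotic_Ei : asymptotic_to
  (fun x : R => -1 + 2 * x + 2 * ((1 - x ^+ 2) / x) *
     expR (- ((x + 1) ^+ 2 / x)) * Ei ((x + 1) ^+ 2 / x))
  (-1 + 2 * fpsX R + 2 * ((1 - fpsX R) / (1 + fpsX R)) * fps_fact_sum R).
Proof.
apply: asymptotic_of_expansion => N.
have e1 := expansion_nat R N 1; have e2 := expansion_nat R N 2.
have ex := expansionX R N.
have a1 := expansionD (expansionN e1) (expansionM e2 ex).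
have a2 := expansionM (expansionD e1 (expansionN ex)) (expansion_onePXV R N).
(* The factor z = (x + 1)^2 / x turns (1 - x) / (1 + x) into (1 - x^2) / x. *)
have a3 := expansionM (expansionM e2 a2) (expansion_Ei N).
apply: expansion_near (expansionD a1 a3); near=> x.
have x0 : x != 0 by near: x; exact: nbhs_dnbhs_neq.
have x2 : `|x| <= 2^-1 by near: x; apply: dnbhs0_le; rewrite invr_gt0.
have x1 : 1 + x != 0.
  by move: x2; rewrite ler_norml => /andP[xl _]; rewrite gt_eqF//; lra.
rewrite /=; set E := expR _; set G := Ei _.
by field; rewrite x0 x1.
Unshelve. all: by end_near. Qed.

End Conclusion.

Local Open Scope classical_set_scope.
Local Open Scope complex_scope.
Local Open Scope ring_scope.

Theorem theorem1 (R : realType) :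
  (forall n : nat, (1 < n)%N ->
    (menage n)%:R = 2 * n`!%:R *
      Cintegral `[0, +oo[ (fun t : R =>
        ((((t - 2)%:C + sqrtC (t ^+ 2 - 4 * t)%:C) / 2) ^+ n +
         (((t - 2)%:C - sqrtC (t ^+ 2 - 4 * t)%:C) / 2) ^+ n) *
        (expR (- t))%:C) :> R[i]) /\
  [/\ menage_egf R =
        -1 + 2 * fpsX R +
        2 * (let x := fpsX {poly R} in let t := fpsC 'X in
             laplace ((x ^+ 2 - 1) / (x * t - (x + 1) ^+ 2))),
      (-1 + 2 * fpsX R +
        2 * (let x := fpsX {poly R} in let t := fpsC 'X in
             laplace ((x ^+ 2 - 1) / (x * t - (x + 1) ^+ 2)))) =
        (let x := fpsX R in
         -1 + 2 * x + 2 * ((1 - x) / (1 + x)) *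
           fps_sum (fun k => k`!%:R * x ^+ k / (1 + x) ^+ (2 * k))) &
      asymptotic_to
        (fun x : R => -1 + 2 * x + 2 * ((1 - x ^+ 2) / x) *
           expR (- ((x + 1) ^+ 2 / x)) * Ei ((x + 1) ^+ 2 / x))
        (let x := fpsX R in
         -1 + 2 * x + 2 * ((1 - x) / (1 + x)) *
           fps_sum (fun k => k`!%:R * x ^+ k / (1 + x) ^+ (2 * k)))].
Proof.
split; first exact: menage_Cintegral.
split; cbv zeta; rewrite ?laplace_menage.
- exact: menage_egfE.
- by rewrite fps_laplace_menage [2 * (_ * fps_fact_sum R)]mulrA.
- exact: asymptotic_Ei.
Qed.
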